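(* Let $k$ be any unital commutative ring and let $G$ be any group. Then the pair $\left({\tt Cof}(kG),{\tt Cof}(kG)^{\perp}\right)$ is a complete hereditary cotorsion pair in the category of $kG$-modules.
   Context: The tensor product $M\otimes_k N$ of two $kG$-modules is a $kG$-module with the diagonal action $g(x\otimes y)=gx\otimes gy$. Let $B=B(G,k)$ be the $kG$-module of all functions $G\to k$ taking only finitely many values, with action $(g\cdot f)(x)=f(g^{-1}x)$. A $kG$-module $M$ is cofibrant if the diagonal $kG$-module $M\otimes_k B$ is projective; ${\tt Cof}(kG)$ is the class of cofibrant $kG$-modules. For a class ${\tt S}$ of modules over a ring $R$, ${\tt S}^{\perp}$ is the class of modules $N$ with ${\rm Ext}^1_R(S,N)=0$ for all $S\in{\tt S}$, and $^{\perp}{\tt S}$ is the class of modules $M$ with ${\rm Ext}^1_R(M,S)=0$ for all $S\in{\tt S}$. A pair $({\tt U},{\tt V})$ of module classes is a cotorsion pair if ${\tt U}={}^{\perp}{\tt V}$ and ${\tt U}^{\perp}={\tt V}$. It is hereditary if ${\rm Ext}^i_R(U,V)=0$ for all $i>0$, $U\in{\tt U}$, $V\in{\tt V}$. It is complete if for any module $M$ there are short exact sequences $0\to V\to U\to M\to 0$ and $0\to M\to V'\to U'\to 0$ with $U,U'\in{\tt U}$ and $V,V'\in{\tt V}$. *)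

(* Defs.v *)
From HB Require Import structures.
From mathcomp Require Import all_boot all_algebra finmap.
From mathcomp Require Import boolp classical_sets functions cardinality.

Set Implicit Arguments.
Unset Strict Implicit.
Unset Printing Implicit Defensive.

Import GRing.Theory.
Local Open Scope quotient_scope.
Local Open Scope ring_scope.

Section FreeModule.
Variables (R : pzRingType) (X : choiceType).

(* The free R-module on X, with basis the elements [basis x]; [free_ext f] is the
   linear extension of f : X -> V. *)
Definition freemod : Type := {fsfun X -> R with 0}.

HB.instance Definition _ := Choice.on freemod.

Implicit Types a b : freemod.

Definition fm_zero : freemod := [fsfun with 0].
Definition fm_opp a : freemod := [fsfun x in finsupp a => - a x].
Definition fm_add a b : freemod :=
  [fsfun x in (finsupp a `|` finsupp b)%fset => a x + b x].
Definition fm_scale (c : R) a : freemod := [fsfun x in finsupp a => c * a x].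

Lemma fm_addE a b x : fm_add a b x = a x + b x.
Proof.
rewrite fsfunE inE; case: (finsuppP a x) => //= ; case: (finsuppP b x) => //= *.
by rewrite addr0.
Qed.

Lemma fm_oppE a x : fm_opp a x = - a x.
Proof. by rewrite fsfunE; case: finsuppP => //=; rewrite oppr0. Qed.

Lemma fm_scaleE c a x : fm_scale c a x = c * a x.
Proof. by rewrite fsfunE; case: finsuppP => //=; rewrite mulr0. Qed.

Lemma fm_eqP a b : (forall x, a x = b x) -> a = b.
Proof. by move=> ab; apply/fsfunP. Qed.

Fact fm_addA : associative fm_add.
Proof. by move=> a b c; apply: fm_eqP => x; rewrite !fm_addE addrA. Qed.
Fact fm_addC : commutative fm_add.
Proof. by move=> a b; apply: fm_eqP => x; rewrite !fm_addE addrC. Qed.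
Fact fm_add0 : left_id fm_zero fm_add.
Proof. by move=> a; apply: fm_eqP => x; rewrite fm_addE fsfunE add0r. Qed.
Fact fm_addN : left_inverse fm_zero fm_opp fm_add.
Proof. by move=> a; apply: fm_eqP => x; rewrite fm_addE fm_oppE fsfunE addNr. Qed.
HB.instance Definition _ :=
  GRing.isZmodule.Build freemod fm_addA fm_addC fm_add0 fm_addN.

Fact fm_scaleA c d a : fm_scale c (fm_scale d a) = fm_scale (c * d) a.
Proof. by apply: fm_eqP => x; rewrite !fm_scaleE mulrA. Qed.
Fact fm_scale1 : left_id 1 fm_scale.
Proof. by move=> a; apply: fm_eqP => x; rewrite fm_scaleE mul1r. Qed.
Fact fm_scaleDr : right_distributive fm_scale +%R.
Proof.
by move=> c a b; apply: fm_eqP => x; rewrite fm_scaleE !fm_addE !fm_scaleE mulrDr.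
Qed.
Fact fm_scaleDl a : {morph fm_scale^~ a : c d / c + d}.
Proof.
by move=> c d; apply: fm_eqP => x; rewrite fm_scaleE !fm_addE !fm_scaleE mulrDl.
Qed.
HB.instance Definition _ :=
  GRing.Zmodule_isLmodule.Build R freemod fm_scaleA fm_scale1 fm_scaleDr fm_scaleDl.

Lemma fmD a b x : (a + b) x = a x + b x. Proof. exact: fm_addE. Qed.
Lemma fmZ c a x : (c *: a) x = c * a x. Proof. exact: fm_scaleE. Qed.
Lemma fm0 x : (0 : freemod) x = 0. Proof. by rewrite fsfunE. Qed.

Definition basis (x : X) : freemod := [fsfun y in [fset x]%fset => 1].

Lemma basisE x y : basis x y = (y == x)%:R.
Proof. by rewrite fsfunE inE; case: eqP. Qed.

Section Extension.
Variable V : lmodType R.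
Implicit Types f : X -> V.

Definition free_ext f a : V := \sum_(x <- finsupp a) a x *: f x.

Lemma free_extE f a (S : {fset X}) : (finsupp a `<=` S)%fset ->
  free_ext f a = \sum_(x <- S) a x *: f x.
Proof.
move=> sub; apply: big_fset_incl => // x _ /fsfun_dflt ->.
by rewrite scale0r.
Qed.

Lemma free_ext_linear f : linear (free_ext f).
Proof.
move=> c a b.
pose u : freemod := c *: a + b; rewrite -/u.
have uE x : u x = c * (a : freemod) x + (b : freemod) x by rewrite /u fmD fmZ.
pose S := (finsupp (a : freemod) `|` (finsupp (b : freemod) `|` finsupp u))%fset.
rewrite !(@free_extE _ _ S) /S ?fsubsetUl //; last 2 first.
- by rewrite fsetUCA fsubsetUl.
- by rewrite fsetUA fsubsetUr.
rewrite scaler_sumr -big_split /=; apply: eq_bigr => x _.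
by rewrite uE scalerDl scalerA.
Qed.
HB.instance Definition _ f :=
  GRing.isLinear.Build R freemod V _ (free_ext f) (free_ext_linear f).

Lemma free_ext_basis f x : free_ext f (basis x) = f x.
Proof.
rewrite (@free_extE _ _ [fset x]%fset) ?big_seq_fset1 ?basisE ?eqxx ?scale1r //.
exact: finsupp_sub.
Qed.

End Extension.

Lemma free_ext_id a : free_ext basis a = a.
Proof.
apply: fm_eqP => y; rewrite /free_ext.
have sumE (s : seq X) (F : X -> freemod) :
    (\sum_(x <- s) F x) y = \sum_(x <- s) F x y.
  by elim/big_ind2: _ => [|u ? v ? <- <-|]; rewrite ?fm0 ?fmD.
rewrite sumE; case: (finsuppP a y) => [ya|ya].
  rewrite big_seq big1 // => x xa; rewrite fmZ basisE.
  by case: eqP xa ya => [->|_ _ _]; rewrite ?mulr0 // => ->.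
rewrite (big_fsetD1 y) //= fmZ basisE eqxx mulr1 big_seq big1 ?addr0 // => x.
by rewrite !inE fmZ basisE eq_sym => /andP[/negPf -> _]; rewrite mulr0.
Qed.

Lemma free_linear_eq (V : lmodType R) (f g : freemod -> V) :
  linear f -> linear g -> (forall x, f (basis x) = g (basis x)) -> f =1 g.
Proof.
move=> lf lg fg a.
pose F : {linear freemod -> V} := HB.pack f (GRing.isLinear.Build _ _ _ _ f lf).
pose H : {linear freemod -> V} := HB.pack g (GRing.isLinear.Build _ _ _ _ g lg).
suff: F a = H a by [].
rewrite -[a]free_ext_id /free_ext !linear_sum.
by apply: eq_bigr => x _; rewrite !linearZ /= fg.
Qed.

End FreeModule.

Section Submodules.
Variables (R : pzRingType).

Section Kernel.
Variables (U V : lmodType R) (f : {linear U -> V}).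

Definition ker_pred : {pred U} := fun x => f x == 0.

Fact ker_closed : GRing.subsemimod_closed ker_pred.
Proof.
split=> [|c x]; last by rewrite !unfold_in linearZ /= => /eqP ->; rewrite scaler0.
split=> [|x y]; rewrite !unfold_in ?linear0 // linearD => /eqP -> /eqP ->.
by rewrite addr0.
Qed.
HB.instance Definition _ := GRing.isSubmodClosed.Build R U ker_pred ker_closed.

Definition kermod : Type := {x : U | ker_pred x}.
HB.instance Definition _ := SubChoice.on kermod.
HB.instance Definition _ := [SubChoice_isSubLmodule of kermod by <:].
End Kernel.

Section Span.
Variables (V : lmodType R) (X : V -> Prop).

(* The intersection of all submodules of V containing X; [quotmod] is V / span. *)
Definition span : {pred V} := fun v =>
  `[< forall S : {pred V}, GRing.subsemimod_closed S ->
        (forall x, X x -> x \in S) -> v \in S >].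

Lemma sub_span x : X x -> x \in span.
Proof. by move=> Xx; apply/asboolP => S _; apply. Qed.

Fact span_closed : GRing.subsemimod_closed span.
Proof.
split=> [|c x /asboolP xS]; last first.
  by apply/asboolP => S cS XS; apply: (cS.2); apply: xS.
split=> [|x y /asboolP xS /asboolP yS]; apply/asboolP => S cS XS; first exact: cS.1.1.
by apply: (cS.1.2); [apply: xS | apply: yS].
Qed.
HB.instance Definition _ := GRing.isSubmodClosed.Build R V span span_closed.
End Span.

Section Quotient.
Variables (V : lmodType R) (X : V -> Prop).
Local Notation S := (span X).

Definition quotmod : Type := Quotient.quot S.
HB.instance Definition _ := GRing.Zmodule.on quotmod.

Definition qpi (x : V) : quotmod := \pi_(Quotient.quot S) x.
Definition qrepr (q : quotmod) : V := repr (q : Quotient.quot S).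

Lemma qreprK q : qpi (qrepr q) = q. Proof. exact: reprK. Qed.
Lemma qpi_eq x y : (qpi x = qpi y) <-> (x - y \in S).
Proof. by rewrite Quotient.idealrBE; split=> /eqP. Qed.
Lemma qpiD x y : qpi (x + y) = qpi x + qpi y.
Proof. exact: (raddfD (\pi_(Quotient.quot S))). Qed.

Definition qscale (c : R) (q : quotmod) : quotmod := qpi (c *: qrepr q).

Lemma qpiZ c x : qpi (c *: x) = qscale c (qpi x).
Proof.
by apply/qpi_eq; rewrite -scalerBr rpredZ //; apply/qpi_eq; rewrite qreprK.
Qed.

Fact qscaleA c d q : qscale c (qscale d q) = qscale (c * d) q.
Proof. by rewrite -(qreprK q) -!qpiZ scalerA. Qed.
Fact qscale1 : left_id 1 qscale.
Proof. by move=> q; rewrite -(qreprK q) -!qpiZ scale1r. Qed.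
Fact qscaleDr : right_distributive qscale +%R.
Proof.
by move=> c p q; rewrite -(qreprK p) -(qreprK q) -qpiD -!qpiZ scalerDr qpiD.
Qed.
Fact qscaleDl q : {morph qscale^~ q : c d / c + d}.
Proof. by move=> c d; rewrite -(qreprK q) -!qpiZ scalerDl qpiD. Qed.
HB.instance Definition _ :=
  GRing.Zmodule_isLmodule.Build R quotmod qscaleA qscale1 qscaleDr qscaleDl.

Lemma qpi_linear : linear qpi.
Proof. by move=> c x y; rewrite qpiD qpiZ. Qed.
HB.instance Definition _ := GRing.isLinear.Build R V quotmod _ qpi qpi_linear.

Lemma quot_lift_linear (W : lmodType R) (f : {linear V -> W}) :
  (forall x, x \in S -> f x = 0) ->
  linear (f \o qrepr) /\ forall x, f (qrepr (qpi x)) = f x.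
Proof.
move=> fS; have fE x : f (qrepr (qpi x)) = f x.
  apply/eqP; rewrite -subr_eq0 -linearB; apply/eqP/fS/qpi_eq.
  exact: qreprK.
split=> // c p q /=.
by rewrite -(qreprK p) -(qreprK q) -linearP !fE linearP.
Qed.
End Quotient.

End Submodules.

Section HomologicalAlgebra.
Variable R : pzRingType.

Definition modclass := lmodType R -> Prop.

Definition projective : modclass := fun P =>
  forall (M N : lmodType R) (p : {linear M -> N}) (f : {linear P -> N}),
    (forall y, exists x, p x = y) ->
    exists h : {linear P -> M}, forall x, p (h x) = f x.

Definition short_exact (A B C : lmodType R)
    (i : {linear A -> B}) (p : {linear B -> C}) : Prop :=
  [/\ injective i, (forall y, exists x, p x = y)
    & forall x, p x = 0 <-> exists a, i a = x].

(* Ext is computed from the standard free resolution of M: F_n is the free module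
   on the underlying set of the n-th syzygy, where the 0-th syzygy is M and the
   (n+1)-st one is the kernel of the canonical map from F_n onto the n-th one.
   [Ext M N n] is the n-th cohomology group of Hom(F, N). *)
Section Ext.
Variables M N : lmodType R.

Definition free_cover (L : lmodType R) : {linear freemod R L -> L} := free_ext id.

Fixpoint syzygy (n : nat) : lmodType R :=
  if n is m.+1 then kermod (free_cover (syzygy m)) else M.

Definition resol (n : nat) : lmodType R := freemod R (syzygy n).

Definition resol_d (n : nat) (x : resol n.+1) : resol n :=
  sval (free_cover (syzygy n.+1) x).

Lemma resol_d_linear n : linear (@resol_d n).
Proof. by move=> c x y; rewrite /resol_d linearP. Qed.
HB.instance Definition _ n :=
  GRing.isLinear.Build R (resol n.+1) (resol n) _ (@resol_d n) (@resol_d_linear n).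

Lemma resol_dd n (x : resol n.+2) : resol_d (resol_d x) = 0.
Proof.
by rewrite /resol_d; have /eqP -> := svalP (free_cover (syzygy n.+2) x).
Qed.

Definition cocycle (n : nat) : {pred (resol n -> N)} := fun f =>
  `[< linear f /\ forall x : resol n.+1, f (resol_d x) = 0 >].

Fact cocycle_closed n : zmod_closed (@cocycle n).
Proof.
split=> [|f g /asboolP[lf f0] /asboolP[lg g0]]; apply/asboolP.
  by split=> // c x y; rewrite /GRing.zero /= scaler0 addr0.
have E x : (f - g) x = f x - g x by [].
by split=> [c x y|x]; rewrite !E ?f0 ?g0 ?subr0 // lf lg scalerBr opprD addrACA.
Qed.
HB.instance Definition _ n :=
  GRing.isZmodClosed.Build (resol n -> N) (@cocycle n) (@cocycle_closed n).

Definition cocycles (n : nat) : Type := {f : resol n -> N | cocycle f}.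
HB.instance Definition _ n := SubChoice.on (cocycles n).
HB.instance Definition _ n := [SubChoice_isSubZmodule of cocycles n by <:].

(* The complex Hom(F_n, N) is zero in degree -1. *)
Definition coboundary (n : nat) : {pred cocycles n} :=
  match n return {pred cocycles n} with
  | 0 => fun f => f == 0
  | m.+1 => fun f =>
      `[< exists2 g : resol m -> N, linear g & forall x, val f x = g (resol_d x) >]
  end.

Fact coboundary_closed n : zmod_closed (@coboundary n).
Proof.
case: n => [|n]; split.
- exact: eqxx.
- by move=> f g /eqP -> /eqP ->; rewrite subr0; exact: eqxx.
- apply/asboolP; exists (fun=> 0) => [c x y|x]; first by rewrite scaler0 addr0.
  by [].
- move=> f g /asboolP[f' lf fE] /asboolP[g' lg gE]; apply/asboolP.
  exists (fun x => f' x - g' x) => [c x y|x].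
    by rewrite lf lg scalerBr opprD addrACA.
  by rewrite -fE -gE.
Qed.
HB.instance Definition _ n :=
  GRing.isZmodClosed.Build (cocycles n) (@coboundary n) (@coboundary_closed n).

Definition Ext (n : nat) : zmodType := Quotient.quot (@coboundary n).

Definition Ext_trivial (n : nat) : Prop := forall e : Ext n, e = 0.
End Ext.

Lemma free_cover_surj (M : lmodType R) y : exists x, free_cover M x = y.
Proof. by exists (basis R y); exact: free_ext_basis. Qed.

Lemma resol_exact (M : lmodType R) n (x : resol M n.+1) :
  resol_d x = 0 -> exists y, resol_d y = x.
Proof.
rewrite /resol_d => x0.
have kx : ker_pred (free_cover (syzygy M n.+1)) x by apply/eqP/val_inj.
have [y yE] := @free_cover_surj (syzygy M n.+2)
  (exist (fun z => ker_pred (free_cover (syzygy M n.+1)) z) x kx).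
by exists y; rewrite yE.
Qed.
Lemma resol_exact0 (M : lmodType R) (x : resol M 0) :
  free_cover M x = 0 -> exists y, resol_d y = x.
Proof.
move=> /eqP x0.
have [y yE] := @free_cover_surj (syzygy M 1)
  (exist (fun z => ker_pred (free_cover (syzygy M 0)) z) x x0).
by exists y; rewrite /resol_d yE.
Qed.

Lemma Ext_trivialP (M N : lmodType R) n :
  Ext_trivial M N n.+1 <->
  forall f : {linear resol M n.+1 -> N}, (forall x, f (resol_d x) = 0) ->
   exists g : {linear resol M n -> N}, forall x, f x = g (resol_d x).
Proof.
split=> [H f f0|H e].
  have cf : cocycle (f : _ -> _) by apply/asboolP; split=> // c x y; rewrite linearP.
  pose z : cocycles M N n.+1 := exist (fun h => cocycle h) (f : _ -> _) cf.
  have := H (\pi_(Quotient.quot (@coboundary M N n.+1)) z).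
  rewrite -(raddf0 (\pi_(Quotient.quot (@coboundary M N n.+1)))) => /eqP.
  rewrite -Quotient.idealrBE subr0 => /asboolP[g lg gE].
  pose G : {linear resol M n -> N} := HB.pack g (GRing.isLinear.Build _ _ _ _ g lg).
  by exists G.
rewrite -[e]reprK; case: (repr e) => f cf; have /asboolP[lf f0] := cf.
apply/eqP; rewrite -(raddf0 (\pi_(Quotient.quot (@coboundary M N n.+1)))).
rewrite -Quotient.idealrBE subr0; apply/asboolP.
pose F : {linear resol M n.+1 -> N} := HB.pack f (GRing.isLinear.Build _ _ _ _ f lf).
have [g gE] := H F f0.
by exists g => // c x y; rewrite linearP.
Qed.

Definition rperp (S : modclass) : modclass := fun N =>
  forall M : lmodType R, S M -> Ext_trivial M N 1.
Definition lperp (S : modclass) : modclass := fun M =>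
  forall N : lmodType R, S N -> Ext_trivial M N 1.

Definition cotorsion_pair (U V : modclass) : Prop :=
  (forall M, U M <-> lperp V M) /\ (forall N, rperp U N <-> V N).

Definition hereditary (U V : modclass) : Prop :=
  forall (i : nat) (M N : lmodType R), (0 < i)%N -> U M -> V N -> Ext_trivial M N i.

Definition complete (U V : modclass) : Prop :=
  forall M : lmodType R,
    (exists (V0 U0 : lmodType R) (i : {linear V0 -> U0}) (p : {linear U0 -> M}),
       [/\ U U0, V V0 & short_exact i p]) /\
    (exists (V1 U1 : lmodType R) (i : {linear M -> V1}) (p : {linear V1 -> U1}),
       [/\ U U1, V V1 & short_exact i p]).

End HomologicalAlgebra.

Section GroupRing.
Variables (k : comPzRingType) (G : groupType).

(* The group ring kG: the multiplication is the bilinear extension of that of G.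
   k may be the zero ring, hence the use of possibly trivial rings throughout. *)
Definition grpring : Type := freemod k G.
HB.instance Definition _ := GRing.Lmodule.on grpring.
Implicit Types a b : grpring.

Definition gdelta (g : G) : grpring := basis k g.

Definition gr_mul a b : grpring :=
  free_ext (fun g : G => free_ext (fun h : G => gdelta (g * h)%g) b) a.

Lemma gr_mulE g h : gr_mul (gdelta g) (gdelta h) = gdelta (g * h)%g.
Proof. by rewrite /gr_mul !free_ext_basis. Qed.

Lemma gr_mul_linl b : linear (gr_mul^~ b).
Proof. by move=> c x y; rewrite /gr_mul linearP. Qed.

Lemma gr_mul_linr a : linear (gr_mul a).
Proof.
move=> c x y; rewrite /gr_mul /free_ext scaler_sumr -big_split /=.
apply: eq_bigr => g _; rewrite -!/(free_ext _ _) linearP scalerDr !scalerA.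
by rewrite mulrC.
Qed.

Fact gr_mulA : associative gr_mul.
Proof.
move=> a b c; move: a; apply: free_linear_eq => [|u x y|g].
- exact: gr_mul_linl.
- by rewrite !gr_mul_linl.
move: b; apply: free_linear_eq => [u x y|u x y|h].
- by rewrite gr_mul_linl gr_mul_linr.
- by rewrite gr_mul_linr gr_mul_linl.
move: c; apply: free_linear_eq => [u x y|u x y|l].
- by rewrite !gr_mul_linr.
- by rewrite gr_mul_linr.
by rewrite !gr_mulE mulgA.
Qed.
Fact gr_mul1 : left_id (gdelta 1%g) gr_mul.
Proof.
apply: free_linear_eq => [|//|g]; first exact: gr_mul_linr.
by rewrite gr_mulE mul1g.
Qed.
Fact gr_mulr1 : right_id (gdelta 1%g) gr_mul.
Proof.
apply: free_linear_eq => [|//|g]; first exact: gr_mul_linl.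
by rewrite gr_mulE mulg1.
Qed.
Fact gr_mulDl : left_distributive gr_mul +%R.
Proof. by move=> a b c; have := gr_mul_linl c 1 a b; rewrite !scale1r. Qed.
Fact gr_mulDr : right_distributive gr_mul +%R.
Proof. by move=> a b c; have := gr_mul_linr a 1 b c; rewrite !scale1r. Qed.
HB.instance Definition _ :=
  GRing.Zmodule_isPzRing.Build grpring gr_mulA gr_mul1 gr_mulr1 gr_mulDl gr_mulDr.

Lemma gdeltaM g h : gdelta g * gdelta h = gdelta (g * h)%g.
Proof. exact: gr_mulE. Qed.
Lemma gdelta1 : gdelta 1%g = 1. Proof. by []. Qed.
Lemma grpring_scalel (u : k) a b : (u *: a) * b = u *: (a * b).
Proof.
have E : (u *: a + 0) * b = u *: (a * b) + 0 * b by exact: gr_mul_linl.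
by move: E; rewrite mul0r !addr0.
Qed.
Lemma grpring_scaler (u : k) a b : a * (u *: b) = u *: (a * b).
Proof.
have E : a * (u *: b + 0) = u *: (a * b) + a * 0 by exact: gr_mul_linr.
by move: E; rewrite mulr0 !addr0.
Qed.

(* A k-linear action of G; [repmod] is the corresponding kG-module. *)
Record grep (V : lmodType k) := Grep {
  gact : G -> V -> V;
  gact_linear : forall g, linear (gact g);
  gact1 : forall v, gact 1%g v = v;
  gactM : forall g h v, gact (g * h)%g v = gact g (gact h v)
}.

Definition repmod (V : lmodType k) (r : grep V) : Type := V.

Section ModuleOfRep.
Variables (V : lmodType k) (r : grep V).

HB.instance Definition _ := GRing.Zmodule.on (repmod r).

Definition rm_scale (a : grpring) (v : repmod r) : repmod r :=
  free_ext (fun g : G => gact r g v) a.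

Lemma rm_scale_delta g v : rm_scale (gdelta g) v = gact r g v.
Proof. exact: free_ext_basis. Qed.

Lemma rm_scale_linr a : linear (rm_scale a : V -> V).
Proof.
move=> c x y; rewrite /rm_scale /free_ext scaler_sumr -big_split /=.
by apply: eq_bigr => g _; rewrite gact_linear scalerDr !scalerA mulrC.
Qed.

Lemma rm_scale_linl v : linear (rm_scale^~ v : grpring -> V).
Proof. by move=> c x y; rewrite /rm_scale linearP. Qed.

Fact rm_scaleA a b v : rm_scale a (rm_scale b v) = rm_scale (a * b) v.
Proof.
move: a; apply: free_linear_eq => [|c x y|g].
- exact: rm_scale_linl.
- by rewrite mulrDl grpring_scalel rm_scale_linl.
move: b; apply: free_linear_eq => [c x y|c x y|h].
- by rewrite rm_scale_linl rm_scale_linr.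
- by rewrite mulrDr grpring_scaler rm_scale_linl.
by rewrite gdeltaM !rm_scale_delta gactM.
Qed.
Fact rm_scale1 : left_id 1 rm_scale.
Proof. by move=> v; rewrite rm_scale_delta gact1. Qed.
Fact rm_scaleDr : right_distributive rm_scale +%R.
Proof. by move=> a x y; have := rm_scale_linr a 1 x y; rewrite !scale1r. Qed.
Fact rm_scaleDl v : {morph rm_scale^~ v : a b / a + b}.
Proof. by move=> a b; rewrite /rm_scale linearD. Qed.
HB.instance Definition _ :=
  GRing.Zmodule_isLmodule.Build grpring (repmod r) rm_scaleA rm_scale1 rm_scaleDr rm_scaleDl.

Lemma repmod_gdelta g (v : repmod r) : gdelta g *: v = gact r g v.
Proof. exact: rm_scale_delta. Qed.
End ModuleOfRep.

Section Restriction.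
Variable M : lmodType grpring.

(* M as a k-module, by restriction of scalars along k -> kG. *)
Definition resk : Type := M.
HB.instance Definition _ := GRing.Zmodule.on resk.

Definition res_scale (c : k) (m : resk) : resk := (c *: (1 : grpring)) *: (m : M).

Fact res_scaleA c d m : res_scale c (res_scale d m) = res_scale (c * d) m.
Proof. by rewrite /res_scale scalerA grpring_scalel mul1r scalerA. Qed.
Fact res_scale1 : left_id 1 res_scale.
Proof. by move=> m; rewrite /res_scale !scale1r. Qed.
Fact res_scaleDr : right_distributive res_scale +%R.
Proof. by move=> c x y; exact: scalerDr. Qed.
Fact res_scaleDl m : {morph res_scale^~ m : c d / c + d}.
Proof. by move=> c d; rewrite /res_scale !scalerDl. Qed.
HB.instance Definition _ :=
  GRing.Zmodule_isLmodule.Build k resk res_scaleA res_scale1 res_scaleDr res_scaleDl.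

Definition res_act (g : G) (m : resk) : resk := gdelta g *: (m : M).

Fact res_act_linear g : linear (res_act g).
Proof.
move=> c x y; rewrite /res_act [LHS]scalerDr; congr (_ + _).
rewrite [c *: x]/(_ *: _) /= /res_scale [RHS]/(_ *: _) /= /res_scale !scalerA.
by rewrite grpring_scaler grpring_scalel mulr1 mul1r.
Qed.
Fact res_act1 m : res_act 1%g m = m.
Proof. by rewrite /res_act gdelta1 scale1r. Qed.
Fact res_actM g h m : res_act (g * h)%g m = res_act g (res_act h m).
Proof. by rewrite /res_act scalerA gdeltaM. Qed.
Definition resrep : grep resk := Grep res_act_linear res_act1 res_actM.
End Restriction.

End GroupRing.

Section Tensor.
Variables (k : comPzRingType).

Section Def.
Variables (M N : lmodType k).

Local Notation "[ x , y ]" := (basis k ((x, y) : M * N)).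

Definition tensor_rel (v : freemod k (M * N)%type) : Prop :=
  [\/ exists x x' y, v = [x + x', y] - [x, y] - [x', y],
      exists x y y', v = [x, y + y'] - [x, y] - [x, y'],
      exists c x y, v = [c *: x, y] - c *: [x, y]
    | exists c x y, v = [x, c *: y] - c *: [x, y]].

Definition tensor : lmodType k := quotmod tensor_rel.

Definition tens (x : M) (y : N) : tensor := qpi tensor_rel [x, y].

Lemma tensDl x x' y : tens (x + x') y = tens x y + tens x' y.
Proof.
rewrite -qpiD; apply/qpi_eq; rewrite opprD addrA; apply/sub_span.
by apply: Or41; exists x, x', y.
Qed.
Lemma tensDr x y y' : tens x (y + y') = tens x y + tens x y'.
Proof.
rewrite -qpiD; apply/qpi_eq; rewrite opprD addrA; apply/sub_span.
by apply: Or42; exists x, y, y'.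
Qed.
Lemma tensZl c x y : tens (c *: x) y = c *: tens x y.
Proof. by rewrite -linearZ; apply/qpi_eq/sub_span/Or43; exists c, x, y. Qed.
Lemma tensZr c x y : tens x (c *: y) = c *: tens x y.
Proof. by rewrite -linearZ; apply/qpi_eq/sub_span/Or44; exists c, x, y. Qed.

Lemma tensor_linear_eq (V : lmodType k) (f g : tensor -> V) :
  linear f -> linear g -> (forall x y, f (tens x y) = g (tens x y)) -> f =1 g.
Proof.
move=> lf lg fg t; rewrite -(qreprK t); move: (qrepr t).
by apply: free_linear_eq => [c a b|c a b|[x y]]; rewrite ?linearP ?lf ?lg // fg.
Qed.
End Def.

Section Map.
Variables (M M' N N' : lmodType k) (f : M -> M') (g : N -> N').
Hypotheses (lf : linear f) (lg : linear g).

Definition tensor_map (t : tensor M N) : tensor M' N' :=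
  free_ext (fun p : M * N => tens (f p.1) (g p.2)) (qrepr t).

Lemma tensor_map_subproof : linear tensor_map /\
  forall x y, tensor_map (tens x y) = tens (f x) (g y).
Proof.
pose F := free_ext (fun p : M * N => tens (f p.1) (g p.2)).
have FE x y : F (basis k (x, y)) = tens (f x) (g y) by rewrite /F free_ext_basis.
have fD x y : f (x + y) = f x + f y by have := lf 1 x y; rewrite !scale1r.
have gD x y : g (x + y) = g x + g y by have := lg 1 x y; rewrite !scale1r.
have f0 : f 0 = 0 by apply: (addrI (f 0)); rewrite -fD !addr0.
have g0 : g 0 = 0 by apply: (addrI (g 0)); rewrite -gD !addr0.
have fZ c x : f (c *: x) = c *: f x by have := lf c x 0; rewrite f0 !addr0.
have gZ c x : g (c *: x) = c *: g x by have := lg c x 0; rewrite g0 !addr0.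
have Frel v : v \in span (@tensor_rel M N) -> F v = 0.
  move=> /asboolP /(_ (ker_pred F) (ker_closed F)) vF; apply/eqP/vF => {vF}{}v.
  rewrite unfold_in; case.
  - by move=> [x [x' [y ->]]]; rewrite !linearB /= !free_ext_basis /= fD tensDl addrAC addrK subrr.
  - by move=> [x [y [y' ->]]]; rewrite !linearB /= !free_ext_basis /= gD tensDr addrAC addrK subrr.
  - by move=> [c [x [y ->]]]; rewrite linearB linearZ /= !free_ext_basis /= fZ tensZl subrr.
  - by move=> [c [x [y ->]]]; rewrite linearB linearZ /= !free_ext_basis /= gZ tensZr subrr.
have [linF qF] := quot_lift_linear Frel.
by split=> // x y; rewrite -FE; exact: qF.
Qed.

Lemma tensor_map_linear : linear tensor_map.
Proof. exact: tensor_map_subproof.1. Qed.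
Lemma tensor_mapE x y : tensor_map (tens x y) = tens (f x) (g y).
Proof. exact: tensor_map_subproof.2. Qed.
End Map.
End Tensor.

Section Cofibrant.
Variables (k : comPzRingType) (G : groupType).
Local Notation kG := (grpring k G).

Section Diagonal.
Variables M N : lmodType kG.

Definition diag_act (g : G) : tensor (resk M) (resk N) -> tensor (resk M) (resk N) :=
  tensor_map (@res_act _ _ M g) (@res_act _ _ N g).

Lemma diag_actE g (x : resk M) (y : resk N) :
  diag_act g (tens x y) = tens (res_act g x) (res_act g y).
Proof. by apply: tensor_mapE; apply: res_act_linear. Qed.

Fact diag_act_linear g : linear (diag_act g).
Proof. by apply: tensor_map_linear; apply: res_act_linear. Qed.
Fact diag_act1 t : diag_act 1%g t = t.
Proof.
apply: (tensor_linear_eq (@diag_act_linear _) (g := id)) => // x y.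
by rewrite diag_actE !res_act1.
Qed.
Fact diag_actM g h t : diag_act (g * h)%g t = diag_act g (diag_act h t).
Proof.
move: t; apply: tensor_linear_eq => [|c s t|x y]; first exact: diag_act_linear.
  by rewrite !diag_act_linear.
by rewrite !diag_actE !res_actM.
Qed.

Definition diag_tensor : lmodType kG :=
  repmod (Grep diag_act_linear diag_act1 diag_actM).

Lemma diag_tensor_gdelta (g : G) (x : M) (y : N) :
  gdelta k g *: (tens (x : resk M) (y : resk N) : diag_tensor)
  = tens (gdelta k g *: x : resk M) (gdelta k g *: y : resk N).
Proof. by rewrite repmod_gdelta; exact: diag_actE. Qed.
End Diagonal.

Definition finite_valued : {pred (G -> k^o)} := fun f => `[< finite_set (range f) >].

Fact finite_valued_closed : GRing.subsemimod_closed finite_valued.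
Proof.
split; [split|].
- apply/asboolP; apply: (sub_finite_set (B := [set 0]%classic)) => //.
  by move=> _ [x _ <-].
- move=> f g /asboolP ff /asboolP fg; apply/asboolP.
  apply: (sub_finite_set (B := [set u + v | u in range f & v in range g]%classic)).
    by move=> _ [x _ <-]; exists (f x); [exists x|exists (g x); [exists x|]].
  exact: finite_image2.
- move=> c f /asboolP ff; apply/asboolP.
  apply: (sub_finite_set (B := [set c *: u | u in range f]%classic)).
    by move=> _ [x _ <-]; exists (f x); first by exists x.
  exact: finite_image.
Qed.
HB.instance Definition _ :=
  GRing.isSubmodClosed.Build k (G -> k^o) finite_valued finite_valued_closed.

Definition fvfun : Type := {f : G -> k^o | finite_valued f}.
HB.instance Definition _ := SubChoice.on fvfun.
HB.instance Definition _ := [SubChoice_isSubLmodule of fvfun by <:].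

Fact fv_act_subproof (g : G) (f : fvfun) :
  finite_valued (fun x => val f (g^-1 * x)%g).
Proof.
apply/asboolP; have /asboolP := valP f; apply: sub_finite_set.
by move=> _ [x _ <-]; exists (g^-1 * x)%g.
Qed.

Definition fv_act (g : G) (f : fvfun) : fvfun := exist (fun h => finite_valued h) _ (fv_act_subproof g f).

Lemma fv_actE g f x : val (fv_act g f) x = val f (g^-1 * x)%g. Proof. by []. Qed.

Fact fv_act_linear g : linear (fv_act g).
Proof. by move=> c u v; apply: val_inj; apply: funext. Qed.
Fact fv_act1 f : fv_act 1%g f = f.
Proof. by apply: val_inj; apply: funext => x; rewrite fv_actE invg1 mul1g. Qed.
Fact fv_actM g h f : fv_act (g * h)%g f = fv_act g (fv_act h f).
Proof. by apply: val_inj; apply: funext => x; rewrite !fv_actE invgM mulgA. Qed.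

(* The kG-module B(G,k). *)
Definition Bmod : lmodType kG := repmod (Grep fv_act_linear fv_act1 fv_actM).

Definition cofibrant : modclass kG := fun M => projective (diag_tensor M Bmod).

End Cofibrant.

(* Main.v *)
From HB Require Import structures.
From mathcomp Require Import all_boot all_algebra finmap ssrAC.
From mathcomp Require Import boolp classical_sets functions cardinality wochoice.
Require Import Defs.

(** The functor [Hom_k(B, -)] is right adjoint to [- (x) B], and [B] is [k]-projective
    (Noebeling's theorem), so [M] is cofibrant iff Ext^1(M, Hom_k(B, Z)) = 0 for all [Z].
    Hence Cof is the left class of a cotorsion pair, which is hereditary because [- (x) B]
    preserves exactness and projectivity.

    Completeness rests on a set S of small cofibrant modules with the same right class.
    If [M (x) B] is a direct summand of a free module, the submodules of [M] whose tensor
    product with [B] is compatible with the splitting are closed under unions of chains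
    and can be enlarged by bounded steps with cofibrant quotients, which makes [M] an
    iterated extension of members of S.  The small object argument is carried out at one
    stroke, as the module freely generated by [N] together with chosen extensions of all
    maps out of the kernels K, where S = {F / K}; its freeness yields the lifting property
    that puts the cokernel of [N] in the left class.  [N] embeds in it because [N] embeds in the
    module of functions [G -> N], which is a [B]-module and thus a retract of a Hom_k(B, Z). *)

Set Implicit Arguments.
Unset Strict Implicit.
Unset Printing Implicit Defensive.

Import GRing.Theory.
Local Open Scope classical_set_scope.
Local Open Scope quotient_scope.
Local Open Scope ring_scope.

(** * Linear algebra and Ext *)

Section Linear.
Variable R : pzRingType.

(** Where a transfinite recursion would be usual, Zorn's lemma is applied to partial transversals
    ([transversal_chain]); this one argument serves both Noebeling's theorem and the deconstruction.
    The size bound on the steps is expressed by making each of them a quotient of the one free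
    module [wfree], which depends on kG and the tensor factor but not on M, so that the kernels form
    a set. In the small object argument a constructor of [cterm] takes a whole family of terms
    indexed by F, which does the work of the usual cofinality bound. Since k may have zero divisors,
    Noebeling's theorem is argued with level sets of functions instead of their coefficients.
    Partial maps are total functions that are linear on a subset, and submodules are plain sets, so
    that unions of chains involve no subtypes. *)

Definition lin_of (U V : lmodType R) (f : U -> V) (lf : linear f) :
  {linear U -> V} := HB.pack f (GRing.isLinear.Build R U V _ f lf).

Definition surj (U V : Type) (f : U -> V) := forall y, exists x, f x = y.

Definition submod (V : lmodType R) (S : set V) :=
  S 0 /\ forall c x y, S x -> S y -> S (c *: x + y).

Definition linear_on (U V : lmodType R) (S : set U) (f : U -> V) :=
  forall c x y, S x -> S y -> f (c *: x + y) = c *: f x + f y.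

Definition lker (U V : lmodType R) (f : U -> V) : set U := fun x => f x = 0.

Lemma linear_on0 (U V : lmodType R) (S : set U) (f : U -> V) :
  linear_on S f -> S 0 -> f 0 = 0.
Proof.
move=> lf S0; have := lf 1 0 0 S0 S0; rewrite !scale1r addr0.
by rewrite -{1}[f 0]addr0 => /addrI.
Qed.

Lemma linear_onN (U V : lmodType R) (S : set U) (f : U -> V) x :
  linear_on S f -> S 0 -> S x -> f (- x) = - f x.
Proof.
move=> lf S0 Sx; rewrite -[- x]addr0 -scaleN1r lf // (linear_on0 lf) //.
by rewrite addr0 scaleN1r.
Qed.

Section Submod.
Variables (V : lmodType R) (S : set V).
Hypothesis sS : submod S.

Lemma submodD x y : S x -> S y -> S (x + y).
Proof. by move=> Sx Sy; rewrite -[x]scale1r; apply: sS.2. Qed.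
Lemma submodZ c x : S x -> S (c *: x).
Proof. by move=> Sx; rewrite -[_ *: _]addr0; apply: sS.2 => //; exact: sS.1. Qed.
Lemma submodN x : S x -> S (- x).
Proof. by move=> Sx; rewrite -scaleN1r; apply: submodZ. Qed.
Lemma submodB x y : S x -> S y -> S (x - y).
Proof. by move=> Sx Sy; apply: submodD => //; apply: submodN. Qed.
Lemma submod_sum (I : Type) (r : seq I) (P : pred I) (F : I -> V) :
  (forall i, P i -> S (F i)) -> S (\sum_(i <- r | P i) F i).
Proof. by move=> SF; elim/big_ind: _ => //; [exact: sS.1|exact: submodD]. Qed.
End Submod.

Lemma lker_submod (U V : lmodType R) (f : {linear U -> V}) : submod (lker f).
Proof.
split=> [|c x y]; rewrite /lker ?linear0 // linearP => -> ->.
by rewrite scaler0 addr0.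
Qed.

Lemma preim_submod (U V : lmodType R) (f : {linear U -> V}) (S : set V) :
  submod S -> submod (fun x => S (f x)).
Proof.
by move=> sS; split=> [|c x y Sx Sy]; rewrite ?linear0 ?linearP; [exact: sS.1|apply: sS.2].
Qed.

Lemma qpi_eq0 (V : lmodType R) (S : set V) x : submod S -> qpi S x = 0 <-> S x.
Proof.
move=> sS; rewrite -(linear0 (qpi S)) qpi_eq subr0; split; last exact: sub_span.
move=> /asboolP /(_ (fun x => `[< S x >])) H; apply/asboolP/H => [|y Sy]; last exact/asboolP.
split=> [|c y /asboolP Sy]; last exact/asboolP/(submodZ sS).
by split=> [|y z /asboolP Sy /asboolP Sz]; apply/asboolP; [exact: sS.1|exact: (submodD sS)].
Qed.

Lemma qpi_surj (V : lmodType R) (S : set V) : surj (qpi S).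
Proof. by move=> y; exists (qrepr y); rewrite qreprK. Qed.

Lemma surj_section (U V : Type) (f : U -> V) : surj f -> exists s, cancel s f.
Proof. by move=> /choice[s sK]; exists s. Qed.

Lemma surj_factor (P M W : lmodType R) (p : {linear P -> M}) (f : P -> W) :
  surj p -> linear f -> (forall x, p x = 0 -> f x = 0) ->
  exists g : {linear M -> W}, forall x, g (p x) = f x.
Proof.
move=> /surj_section[s sK] lf f0; pose F := lin_of lf.
have fE x y : p x = p y -> f x = f y.
  move=> pxy; apply/eqP; rewrite -subr_eq0 -[f x - _](linearB F); apply/eqP/f0.
  by rewrite linearB pxy subrr.
have lg : linear (F \o s).
  by move=> c x y /=; rewrite -lf; apply: fE; rewrite linearP !sK.
by exists (lin_of lg) => x; apply: fE; rewrite sK.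
Qed.

(** Injectivity of [p] on [T] makes the preimage in [T] unique, and uniqueness makes the chosen
    preimages linear. *)
Lemma transversal_section (E M : lmodType R) (p : {linear E -> M}) (T : set E) :
  submod T -> (forall x, T x -> p x = 0 -> x = 0) ->
  (forall y, exists2 x, T x & p x = y) ->
  exists s : {linear M -> E}, forall y, p (s y) = y /\ T (s y).
Proof.
move=> sT T0 Ts; have /choice[s sP] y : exists x, T x /\ p x = y.
  by have [x] := Ts y; exists x.
have ls : linear s.
  move=> c x y; apply/eqP; rewrite -subr_eq0; apply/eqP/T0.
    by apply: submodB => //; [exact: (sP _).1|apply: sT.2; exact: (sP _).1].
  by rewrite linearB linearP !(sP _).2 subrr.
by exists (lin_of ls) => y; have [] := sP y.
Qed.

Lemma free_projective (X : choiceType) : projective (freemod R X).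
Proof.
move=> M N p f /surj_section[s sK]; exists (free_ext (fun x => s (f (basis R x)))).
apply: (@free_linear_eq _ _ _ (p \o free_ext _) f) => [c x y|c x y|x] /=.
- by rewrite !linearP.
- by rewrite linearP.
- by rewrite free_ext_basis sK.
Qed.

(* Ext^1(M, N) = 0, expressed through arbitrary presentations of M. *)
Definition extends (M N : lmodType R) :=
  forall (P : lmodType R) (p : {linear P -> M}), surj p ->
  forall f : P -> N, linear_on (lker p) f ->
  exists g : {linear P -> N}, forall x, lker p x -> g x = f x.

(** One projective presentation tests all others: lift [q] to [l : Q -> P] and extend [f \o l] to
    [g] on Q. Any y in P is l v up to ker p, where q v = p y, and f (y - l v) + g v is the wanted
    extension. *)
Lemma extends_of_cover (Q M N : lmodType R) (q : {linear Q -> M}) :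
  projective Q -> surj q ->
  (forall f : Q -> N, linear_on (lker q) f ->
     exists g : {linear Q -> N}, forall x, lker q x -> g x = f x) ->
  extends M N.
Proof.
move=> projQ sq ext P p sp f lf.
have [l lK] := projQ _ _ p q sp.
have lfl : linear_on (lker q) (f \o l).
  by move=> c x y qx qy /=; rewrite linearP lf // /lker lK.
have [g gE] := ext _ lfl.
have [s sK] := surj_section sq.
(* Independence of [v]: two choices differ by an element of [lker q], on which [g] agrees with
   [f \o l]. Linearity below is then a matter of choosing a convenient [v]. *)
have key y v : q v = p y -> f (y - l (s (p y))) + g (s (p y)) = f (y - l v) + g v.
  move=> qv; have K1 : lker p (y - l v) by rewrite /lker linearB lK qv subrr.
  have K2 : lker q (v - s (p y)) by rewrite /lker linearB sK qv subrr.
  have -> : y - l (s (p y)) = 1 *: (y - l v) + l (v - s (p y)).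
    by rewrite scale1r linearB addrA subrK.
  rewrite lf //; last by rewrite /lker lK.
  by rewrite scale1r -[f (l _)]gE // linearB addrA addrNK.
have lh : linear (fun y => f (y - l (s (p y))) + g (s (p y))).
  move=> c x y; rewrite (@key _ (c *: s (p x) + s (p y))); last by rewrite !linearP !sK.
  rewrite (linearP l) (linearP g) opprD addrACA -scalerN -scalerDr lf; last 2 first.
  - by rewrite /lker linearB lK sK subrr.
  - by rewrite /lker linearB lK sK subrr.
  by rewrite !scalerDr addrACA.
exists (lin_of lh) => x px /=; rewrite (@key _ 0); last by rewrite linear0.
by rewrite (linear0 l) (linear0 g) subr0 addr0.
Qed.

Lemma resol_d_ker (M : lmodType R) (x : resol M 1) :
  lker (free_cover M) (resol_d x).
Proof. by have /eqP := svalP (free_cover (syzygy M 1) x). Qed.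

(** By exactness of the resolution, a cocycle on F_1 amounts to a linear map on the kernel of F_0 ->
    M, and it is a coboundary iff that map extends to F_0. [extends_of_cover] passes from this
    presentation to the others. *)
Lemma Ext1P (M N : lmodType R) : Ext_trivial M N 1 <-> extends M N.
Proof.
rewrite Ext_trivialP; split=> [H|H f f0].
  apply: (extends_of_cover (q := free_cover M)); [exact: free_projective|exact: free_cover_surj|].
  move=> h lh; have dK (x : resol M 1) : lker (free_cover M) (resol_d x).
    exact: resol_d_ker.
  have lhd : linear (fun x : resol M 1 => h (resol_d x)).
    by move=> c x y; rewrite linearP lh //; exact: dK.
  have [|g gE] := H (lin_of lhd).
    by move=> x /=; rewrite resol_dd (linear_on0 lh (linear0 _)).
  by exists g => x /resol_exact0[y <-]; rewrite -gE.
have /choice[s sK] (x : resol M 0) : exists y : resol M 1, free_cover M x = 0 -> resol_d y = x.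
  by case: (pselect (free_cover M x = 0)) => [/resol_exact0[y <-]|]; [exists y|exists 0].
have fE (x y : resol M 1) : resol_d x = resol_d y -> f x = f y.
  move=> dxy; have [|z zE] := @resol_exact R M 0 (x - y); first by rewrite linearB /= dxy subrr.
  by apply/eqP; rewrite -subr_eq0 -linearB -zE f0.
have dK (x : resol M 1) : lker (free_cover M) (resol_d x).
  exact: resol_d_ker.
have [|g gE] := H _ (free_cover M) (@free_cover_surj R M) (f \o s).
  move=> c x y Kx Ky /=; rewrite -linearP; apply: fE.
  rewrite sK; first by rewrite linearP /= !sK.
  exact: (lker_submod (free_cover M)).2.
by exists g => x; rewrite gE; [apply: fE; rewrite sK //; exact: dK|exact: dK].
Qed.

(** Dimension shifting holds by conversion: the standard resolution of [syzygy M n] is the tail of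
    that of M. *)
Lemma Ext_syzygy (M N : lmodType R) n :
  Ext_trivial M N n.+1 <-> Ext_trivial (syzygy M n) N 1.
Proof.
split=> /Ext_trivialP H; apply/Ext_trivialP; exact: H.
Qed.

Lemma projective_extends (P N : lmodType R) : projective P -> extends P N.
Proof.
move=> projP; apply: (extends_of_cover (q := (idfun : {linear P -> P}))) => //.
  by move=> y; exists y.
by move=> f lf; exists (\0 : {linear P -> N}) => x; rewrite /lker /= => ->; rewrite (linear_on0 lf).
Qed.

End Linear.

(** * Pushouts, splittings of extensions, and transversals grown by Zorn's lemma *)

Section Pushout.
Variable R : pzRingType.

(** [E] is the pushout of [lker q -> Q] along [f]. Later computations in [E] go through the
    surjection [pi] and its kernel. *)
Lemma pushout (Q M N : lmodType R) (q : {linear Q -> M}) (f : Q -> N) :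
  surj q -> linear_on (lker q) f ->
  exists (E : lmodType R) (pi : {linear (Q * N)%type -> E}) (p : {linear E -> M}),
    [/\ surj pi, forall x n, pi (x, n) = 0 <-> q x = 0 /\ n = - f x
      & forall z, p (pi z) = q z.1].
Proof.
move=> sq lf; pose D : set (Q * N)%type := fun z => q z.1 = 0 /\ z.2 = - f z.1.
have sD : submod D.
  split; first by split; rewrite /= ?linear0 // (linear_on0 lf (linear0 q)) oppr0.
  move=> c [x1 n1] [x2 n2] [/= k1 ->] [/= k2 ->]; split=> /=.
    by rewrite linearP k1 k2 scaler0 addr0.
  by rewrite lf // opprD scalerN.
have lq : linear (fun z : (Q * N)%type => q z.1) by move=> c x y; rewrite linearP.
have [|p pE] := surj_factor (@qpi_surj _ _ D) lq.
  by move=> x /(qpi_eq0 _ sD)[].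
exists (quotmod D), (qpi D), p; split=> //; first exact: qpi_surj.
by move=> x n; rewrite (qpi_eq0 _ sD).
Qed.

(** Push the presentation out along [f] and split the resulting extension of M by N. Then
    [pi (x, 0) - s (p x)] lies in the copy of N and is linear in x; for x in the kernel it is f x,
    because [pi (x, - f x) = 0]. *)
Lemma extends_of_split (M N : lmodType R) :
  (forall (E : lmodType R) (p : {linear E -> M}) (i : {linear N -> E}),
     surj p -> injective i -> (forall x, p x = 0 <-> exists n, i n = x) ->
     exists s : {linear M -> E}, cancel s p) ->
  extends M N.
Proof.
move=> H P p sp f lf; have [E [pi [p' [spi pi0 p'E]]]] := pushout sp lf.
have li : linear (fun n : N => pi (0, n)).
  by move=> c x y; rewrite -linearP; congr (pi (_, _)); rewrite /= scaler0 addr0.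
have lj : linear (fun x : P => pi (x, 0)).
  by move=> c x y; rewrite -linearP; congr (pi (_, _)); rewrite /= scaler0 addr0.
have f0 : f 0 = 0 := linear_on0 lf (linear0 p).
have piB x n y m : pi (x, n) = pi (y, m) -> p x = p y /\ n - m = - f (x - y).
  move=> e; have /pi0[] : pi (x - y, n - m) = 0.
    by rewrite -[(_, _)]/((x, n) - (y, m)) linearB e subrr.
  by rewrite linearB => /eqP; rewrite subr_eq0 => /eqP.
have ij : injective (lin_of li).
  by move=> n m /piB[_]; rewrite subrr f0 oppr0 => /eqP; rewrite subr_eq0 => /eqP.
have [||s sK] := H E p' (lin_of li) _ ij.
- by move=> y; have [x <-] := sp y; exists (pi (x, 0)); rewrite p'E.
- move=> x; split; last by move=> [n <-]; rewrite p'E /= linear0.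
  have [[y n] <-] := spi x; rewrite p'E /= => y0.
  exists (n + f y); rewrite /= -[RHS]addr0.
  have <- : pi (- y, f y) = 0.
    apply/pi0; rewrite linearN y0 oppr0; split=> //.
    by rewrite (linear_onN lf (linear0 p)) ?opprK.
  by rewrite -linearD; congr (pi (_, _)); rewrite /= subrr.
have /choice[g gE] x : exists n, pi (0, n) = pi (x, 0) - s (p x).
  have [[y n] e] := spi (pi (x, 0) - s (p x)).
  have y0 : p y = 0.
    by have := p'E (y, n); rewrite e linearB p'E sK subrr.
  exists (n + f y); rewrite -e -[RHS]addr0.
  have <- : pi (- y, f y) = 0.
    apply/pi0; rewrite linearN y0 oppr0; split=> //.
    by rewrite (linear_onN lf (linear0 p)) ?opprK.
  by rewrite -linearD; congr (pi (_, _)); rewrite /= subrr.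
have lg : linear g.
  move=> c x y; apply: ij; rewrite [RHS]linearP /= !gE.
  by rewrite lj linearP linearP scalerBr opprD addrACA.
exists (lin_of lg) => x px; apply: ij; rewrite /= gE px linear0 subr0.
apply/eqP; rewrite -subr_eq0 -linearB; apply/eqP/pi0; rewrite /= subr0 sub0r.
by split.
Qed.

Lemma ker_corestrict (U V W : lmodType R) (d : {linear V -> W}) (f : U -> V) :
  linear f -> (forall x, d (f x) = 0) ->
  exists g : {linear U -> kermod d}, forall x, val (g x) = f x.
Proof.
move=> lf df; have kf x : ker_pred d (f x) by exact/eqP.
have lg : linear (fun x => exist (fun y => ker_pred d y) (f x) (kf x) : kermod d).
  by move=> c x y; apply: val_inj; rewrite linearP /= lf.
by exists (lin_of lg).
Qed.

Lemma ker_val (V W : lmodType R) (d : {linear V -> W}) (x : kermod d) : d (val x) = 0.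
Proof. by apply/eqP; exact: (valP x). Qed.

(** [Zorn_bigcup] is applied to the sets X with P (A0 [|] X), so that its empty chain is covered by
    P A0. *)
Lemma zorn_above (T : Type) (P : set (set T)) (A0 : set T) : P A0 ->
  (forall F : set (set T), F !=set0 -> (F `<=` P) -> total_on F subset ->
     P (\bigcup_(X in F) X)) ->
  exists A, [/\ (A0 `<=` A), P A & forall B, (A `<=` B) -> P B -> B = A].
Proof.
move=> PA0 PF.
have [F FP Ft|A [PA maxA]] := @Zorn_bigcup T (fun X => P (A0 `|` X)).
  have [->|/set0P F0] := eqVneq F set0; first by rewrite bigcup_set0 setU0.
  have -> : (A0 `|` \bigcup_(X in F) X =
      \bigcup_(Y in [set (A0 `|` X) | X in F]) Y).
    apply/seteqP; split=> x /=.
      case=> [A0x|[X FX Xx]]; last by exists (A0 `|` X); [exists X|right].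
      by have [X FX] := F0; exists (A0 `|` X); [exists X|left].
    by move=> [_ [X FX <-]] [A0x|Xx]; [left|right; exists X].
  apply: PF.
  - by have [X FX] := F0; exists (A0 `|` X); exists X.
  - by move=> _ [X FX <-]; exact: FP.
  - move=> _ _ [X FX <-] [Y FY <-].
    by have [XY|YX] := Ft _ _ FX FY; [left|right]; apply: setUS.
exists (A0 `|` A); split=> [||B AB PB] //.
apply: contrapT => BA; apply: (maxA B); last first.
  by have -> : (A0 `|` B = B) by apply/setUidPr => x A0x; apply: AB; left.
split; first by move=> x Ax; apply: AB; right.
by move=> BsA; apply: BA; apply/seteqP; split=> // x Bx; right; exact: BsA.
Qed.

Lemma bigcup_submod (V : lmodType R) (F : set (set V)) :
  F !=set0 -> total_on F subset -> (forall X, F X -> submod X) ->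
  submod (\bigcup_(X in F) X).
Proof.
move=> [X0 FX0] Ft sF; split; first by exists X0 => //; exact: (sF _ FX0).1.
move=> c x y [X FX Xx] [Y FY Yy].
have [XY|YX] := Ft _ _ FX FY; [exists Y => //|exists X => //].
  by apply: (sF _ FY).2 => //; apply: XY.
by apply: (sF _ FX).2 => //; apply: YX.
Qed.

(** For a submodule [D] this is p(T) + D. *)
Definition img (E W : lmodType R) (p : E -> W) (D : set W) (T : set E) : set W :=
  fun w => exists2 x, T x & D (w - p x).

(** That is, [p] embeds [T] into W/D. *)
Definition transversal (E W : lmodType R) (p : E -> W) (D : set W) (T : set E) :=
  submod T /\ forall x, T x -> D (p x) -> x = 0.

(* Transversals [T] are grown along an increasing family [phi S] of subsets of [W], the
   labels [S] being recorded since [phi] need not be strictly increasing. *)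
Lemma transversal_chain (E W : lmodType R) (p : {linear E -> W}) (D : set W)
    (L : Type) (closed : set (set L)) (phi : set L -> set W) (full : set L)
    (T0 : set E) (S0 : set L) :
  transversal p D T0 -> closed S0 -> img p D T0 = phi S0 ->
  (forall F : set (set L), F !=set0 -> total_on F subset -> F `<=` closed ->
     closed (\bigcup_(S in F) S) /\ phi (\bigcup_(S in F) S) `<=` \bigcup_(S in F) phi S) ->
  (forall S S', S `<=` S' -> phi S `<=` phi S') ->
  (forall T S, transversal p D T -> closed S -> img p D T = phi S ->
     (exists2 l, full l & ~ S l) ->
     exists T' S', [/\ transversal p D T', closed S' & img p D T' = phi S'] /\
       [/\ T `<=` T', S `<=` S' & exists2 l, S' l & ~ S l]) ->
  exists T S, [/\ transversal p D T, closed S, img p D T = phi S & full `<=` S].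
Proof.
move=> tT0 cS0 e0 chain mono step.
(* A pair (T, S) is coded as a single subset of the disjoint union [E + L], so that Zorn's lemma for
   inclusion applies. *)
pose ET (A : set (E + L)) : set E := inl @^-1` A.
pose LS (A : set (E + L)) : set L := inr @^-1` A.
pose P A := [/\ transversal p D (ET A), closed (LS A) & img p D (ET A) = phi (LS A)].
pose mk (T : set E) (S : set L) : set (E + L) :=
  fun z => match z with inl x => T x | inr l => S l end.
have [||A [_ [tT cS eTS] maxA]] := @zorn_above _ P (mk T0 S0); first by [].
  move=> F [A0 FA0] FP Ft.
  have chE : [set ET A | A in F] !=set0 by exists (ET A0); exists A0.
  have EU : ET (\bigcup_(A in F) A) = \bigcup_(X in [set ET A | A in F]) X.
    by rewrite bigcup_image.
  have LU : LS (\bigcup_(A in F) A) = \bigcup_(X in [set LS A | A in F]) X.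
    by rewrite bigcup_image.
  have tE : total_on [set ET A | A in F] subset.
    move=> _ _ [A FA <-] [B FB <-].
    by have [AB|BA] := Ft _ _ FA FB; [left|right] => x; [apply: AB|apply: BA].
  have tL : total_on [set LS A | A in F] subset.
    move=> _ _ [A FA <-] [B FB <-].
    by have [AB|BA] := Ft _ _ FA FB; [left|right] => x; [apply: AB|apply: BA].
  have [||cU phiU] := chain [set LS A | A in F] _ tL.
  - by exists (LS A0); exists A0.
  - by move=> _ [A FA <-]; have [] := FP _ FA.
  rewrite /P EU LU; split=> //.
    split; first by apply: bigcup_submod => // _ [A FA <-]; have [[]] := FP _ FA.
    by move=> x [_ [A FA <-] Ax]; have [[_ tA] _ _] := FP _ FA; exact: tA.
  apply/seteqP; split=> w.
    move=> [x [_ [A FA <-] Ax] Dx]; have [_ _ eA] := FP _ FA.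
    apply: (mono (LS A)); first by move=> l Al; exists (LS A) => //; exists A.
    by rewrite -eA; exists x.
  move=> /phiU[_ [A FA <-]]; have [_ _ <-] := FP _ FA; move=> [x Ax Dx].
  by exists x => //; exists (ET A) => //; exists A.
exists (ET A), (LS A); split=> // l fl; apply: contrapT => nSl.
have [|T' [S' [PT [TT SS [l' S'l' nSl']]]]] := step _ _ tT cS eTS; first by exists l.
apply: nSl'; have <- : mk T' S' = A; last by [].
by apply: maxA => // -[x|x] /=; [exact: TT|exact: SS].
Qed.

End Pushout.

(** * The small object argument *)

Section Cells.
Variables (R : pzRingType) (F : lmodType R) (KK : set (set F)) (N : lmodType R).

(* A term [CExt K f x] with [K] not in [KK], or with [f] not linear on [K], is junk:
   [ceq] constrains it by congruence only. *)
Inductive cterm : Type :=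
| CBase of N
| CAdd of cterm & cterm
| CScale of R & cterm
| CExt of set F & (F -> cterm) & F.

(** The least congruence under which terms form a module, [CBase] is linear, and [CExt K f] is a
    linear extension of f from K. The premise of [ceq_ext] compares f and f' on K only, so the
    extension depends on the restriction to K alone. *)
Inductive ceq : cterm -> cterm -> Prop :=
| ceq_refl t : ceq t t
| ceq_sym s t : ceq s t -> ceq t s
| ceq_trans s t u : ceq s t -> ceq t u -> ceq s u
| ceq_add s s' t t' : ceq s s' -> ceq t t' -> ceq (CAdd s t) (CAdd s' t')
| ceq_scale c t t' : ceq t t' -> ceq (CScale c t) (CScale c t')
| ceq_ext K f f' x : (forall y, K y -> ceq (f y) (f' y)) ->
    ceq (CExt K f x) (CExt K f' x)
| ceq_addA s t u : ceq (CAdd s (CAdd t u)) (CAdd (CAdd s t) u)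
| ceq_addC s t : ceq (CAdd s t) (CAdd t s)
| ceq_add0 t : ceq (CAdd (CBase 0) t) t
| ceq_addN t : ceq (CAdd (CScale (-1) t) t) (CBase 0)
| ceq_scaleA c d t : ceq (CScale c (CScale d t)) (CScale (c * d) t)
| ceq_scale1 t : ceq (CScale 1 t) t
| ceq_scaleDr c s t : ceq (CScale c (CAdd s t)) (CAdd (CScale c s) (CScale c t))
| ceq_scaleDl t c d : ceq (CScale (c + d) t) (CAdd (CScale c t) (CScale d t))
| ceq_base c n m : ceq (CBase (c *: n + m)) (CAdd (CScale c (CBase n)) (CBase m))
| ceq_ext_linear K f c x y : KK K ->
    (forall d z w, K z -> K w ->
       ceq (f (d *: z + w)) (CAdd (CScale d (f z)) (f w))) ->
    ceq (CExt K f (c *: x + y)) (CAdd (CScale c (CExt K f x)) (CExt K f y))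
| ceq_ext_extends K f x : KK K ->
    (forall d z w, K z -> K w ->
       ceq (f (d *: z + w)) (CAdd (CScale d (f z)) (f w))) ->
    K x -> ceq (CExt K f x) (f x).

HB.instance Definition _ := gen_eqMixin cterm.
HB.instance Definition _ := gen_choiceMixin cterm.

Definition ceqb : rel cterm := fun s t => `[< ceq s t >].
Fact ceqb_refl : reflexive ceqb.
Proof. by move=> t; apply/asboolP; exact: ceq_refl. Qed.
Fact ceqb_sym : symmetric ceqb.
Proof. by move=> s t; apply/asboolP/asboolP; exact: ceq_sym. Qed.
Fact ceqb_trans : transitive ceqb.
Proof. by move=> t s u /asboolP st /asboolP tu; apply/asboolP; exact: ceq_trans tu. Qed.
Canonical ceqb_equiv := EquivRel ceqb ceqb_refl ceqb_sym ceqb_trans.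

Definition cellmod : Type := {eq_quot ceqb}.
HB.instance Definition _ := Choice.on cellmod.

Definition cl (t : cterm) : cellmod := \pi_({eq_quot ceqb}) t.
Definition cr (v : cellmod) : cterm := repr (v : {eq_quot ceqb}).
Lemma crK : cancel cr cl. Proof. by move=> v; exact: reprK. Qed.
Lemma clP s t : cl s = cl t <-> ceq s t.
Proof.
split; first by move=> /eqmodP/asboolP.
by move=> st; apply/eqmodP/asboolP.
Qed.
Lemma crP t : ceq (cr (cl t)) t. Proof. by apply/clP; rewrite crK. Qed.

Definition c_add u v := cl (CAdd (cr u) (cr v)).
Definition c_scale c v := cl (CScale c (cr v)).
Definition c_zero := cl (CBase 0).
Definition c_opp := c_scale (-1).

Lemma clD s t : cl (CAdd s t) = c_add (cl s) (cl t).
Proof. by apply/clP/ceq_add; apply/ceq_sym/crP. Qed.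
Lemma clZ c t : cl (CScale c t) = c_scale c (cl t).
Proof. by apply/clP/ceq_scale; apply/ceq_sym/crP. Qed.

Lemma cl_ind (P : cellmod -> Prop) : (forall t, P (cl t)) -> forall v, P v.
Proof. by move=> Pcl v; rewrite -[v]crK. Qed.

Fact c_addA : associative c_add.
Proof.
elim/cl_ind=> s; elim/cl_ind=> t; elim/cl_ind=> u.
by rewrite -!clD; apply/clP/ceq_addA.
Qed.
Fact c_addC : commutative c_add.
Proof. by elim/cl_ind=> s; elim/cl_ind=> t; rewrite -!clD; apply/clP/ceq_addC. Qed.
Fact c_add0 : left_id c_zero c_add.
Proof. by elim/cl_ind=> s; rewrite -!clD; apply/clP/ceq_add0. Qed.
Fact c_addN : left_inverse c_zero c_opp c_add.
Proof. by elim/cl_ind=> s; rewrite /c_opp -clZ -!clD; apply/clP/ceq_addN. Qed.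
HB.instance Definition _ :=
  GRing.isZmodule.Build cellmod c_addA c_addC c_add0 c_addN.

Lemma cl_addE s t : cl (CAdd s t) = cl s + cl t. Proof. exact: clD. Qed.

Fact c_scaleA c d v : c_scale c (c_scale d v) = c_scale (c * d) v.
Proof. by elim/cl_ind: v => s; rewrite -!clZ; apply/clP/ceq_scaleA. Qed.
Fact c_scale1 : left_id 1 c_scale.
Proof. by elim/cl_ind=> s; rewrite -!clZ; apply/clP/ceq_scale1. Qed.
Fact c_scaleDr : right_distributive c_scale +%R.
Proof.
move=> c; elim/cl_ind=> s; elim/cl_ind=> t.
by rewrite -cl_addE -!clZ -cl_addE; apply/clP/ceq_scaleDr.
Qed.
Fact c_scaleDl v : {morph c_scale^~ v : c d / c + d}.
Proof. by elim/cl_ind: v => s c d; rewrite -!clZ -cl_addE; apply/clP/ceq_scaleDl. Qed.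
HB.instance Definition _ :=
  GRing.Zmodule_isLmodule.Build R cellmod c_scaleA c_scale1 c_scaleDr c_scaleDl.

Lemma cl_scaleE c t : cl (CScale c t) = c *: cl t. Proof. exact: clZ. Qed.

Fact cbase_linear : linear (fun n => cl (CBase n)).
Proof. by move=> c n m; rewrite -cl_scaleE -cl_addE; apply/clP/ceq_base. Qed.
Definition cbase : {linear N -> cellmod} := lin_of cbase_linear.

(** Representatives of all the values of [h] are chosen at once, and together they are the argument
    of a single [CExt]: one stage of the construction is enough. *)
Lemma cellmod_extends K (h : F -> cellmod) : KK K -> linear_on K h ->
  exists g : {linear F -> cellmod}, forall x, K x -> g x = h x.
Proof.
move=> KK_K lh; pose f x := cr (h x).
have lf d z w : K z -> K w -> ceq (f (d *: z + w)) (CAdd (CScale d (f z)) (f w)).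
  by move=> Kz Kw; apply/clP; rewrite cl_addE cl_scaleE !crK lh.
have lg : linear (fun x => cl (CExt K f x)).
  by move=> c x y; rewrite -cl_scaleE -cl_addE; apply/clP/ceq_ext_linear.
exists (lin_of lg) => x Kx; rewrite -[h x]crK; apply/clP.
exact: (ceq_ext_extends KK_K lf).
Qed.

(* The section is defined on terms: the value on [CExt K f x] is [g x] for a linear
   lift [g] of [CExt K f] extending the values on [f], if there is one. *)
Lemma cellmod_section (E : lmodType R) (p : {linear E -> cellmod}) (u : {linear N -> E}) :
  projective F -> surj p -> (forall n, p (u n) = cbase n) ->
  (forall K, KK K -> submod K) ->
  (forall K (h : F -> E), KK K -> linear_on K h -> (forall x, K x -> p (h x) = 0) ->
     exists g : {linear F -> E}, forall x, p (g x) = 0 /\ (K x -> g x = h x)) ->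
  exists s : {linear cellmod -> E}, (forall v, p (s v) = v) /\ forall n, s (cbase n) = u n.
Proof.
move=> projF /surj_section[sec secK] puE sK pext.
pose lifts (K : set F) (h : F -> E) (w : F -> cellmod) (g : F -> E) :=
  [/\ linear g, forall x, p (g x) = w x & forall x, K x -> g x = h x].
(* The default [sec \o w] is used when no linear lift exists; it need not be linear, but it keeps p
   (ev t) = cl t true on junk terms. *)
pose ev_ext K h w := xget (sec \o w) (lifts K h w).
pose fix ev (t : cterm) : E := match t with
  | CBase n => u n
  | CAdd s t => ev s + ev t
  | CScale c t => c *: ev t
  | CExt K f x => ev_ext K (fun y => ev (f y)) (fun y => cl (CExt K f y)) x
  end.
have evK t : p (ev t) = cl t.
  elim: t => /= [n|s IHs t IHt|c t IHt|K f IHf x].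
  - exact: puE.
  - by rewrite linearD IHs IHt cl_addE.
  - by rewrite linearZ /= IHt cl_scaleE.
  - by rewrite /ev_ext; case: xgetP => [g _ [_ -> _]//|_]; rewrite /= secK.
(* A linear lift [l] exists since F is projective. On K it differs from the prescribed values by a
   map into ker p, and [pext] extends this difference to F, which corrects [l]. *)
have ev_extP K f : KK K ->
    (forall d z w, K z -> K w -> ceq (f (d *: z + w)) (CAdd (CScale d (f z)) (f w))) ->
    linear_on K (ev \o f) ->
    lifts K (ev \o f) (fun y => cl (CExt K f y)) (fun x => ev (CExt K f x)).
  move=> KK_K lf lev.
  have lw : linear (fun x => cl (CExt K f x)).
    by move=> c x y; rewrite -cl_scaleE -cl_addE; apply/clP/ceq_ext_linear.
  have [l lE] := projF _ _ p (lin_of lw) (fun v => ex_intro _ (sec v) (secK v)).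
  have [||g gP] := pext K (fun x => ev (f x) - l x) KK_K.
  - by move=> c x y Kx Ky; have /= -> := lev c x y Kx Ky; rewrite linearP /= scalerBr opprD addrACA.
  - move=> x Kx; rewrite linearB evK lE /=; apply/eqP; rewrite subr_eq0; apply/eqP/clP.
    exact/ceq_sym/ceq_ext_extends.
  have lgl : linear (fun x => g x + l x) by move=> c x y; rewrite !linearP scalerDr addrACA.
  rewrite [X in lifts _ _ _ X](_ : _ = ev_ext K (ev \o f) (fun y => cl (CExt K f y))) //.
  apply: (@xgetPex _ (sec \o _) (lifts _ _ _)); exists (fun x => g x + l x); split=> // x.
    by rewrite linearD (gP x).1 add0r lE.
  by move=> Kx; rewrite (gP x).2 // subrK.
have evP s t : ceq s t -> ev s = ev t.
  elim=> {s t} //=.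
  - by move=> s t u' _ -> _ ->.
  - by move=> s s' t t' _ -> _ ->.
  - by move=> c t t' _ ->.
  (* Both sides choose from the same predicate [lifts], since it sees only the values on K and the
     class of the term; hence the choices coincide. *)
  - move=> K f f' x ff' IH; rewrite /ev_ext.
    have -> : (fun y => cl (CExt K f y)) = (fun y => cl (CExt K f' y)).
      by apply/funext => y; apply/clP/ceq_ext.
    congr (xget _ _ _); apply/funext => g; apply/propext.
    by split=> -[lg pg Kg]; split=> // y Ky; rewrite Kg // IH.
  - by move=> *; rewrite addrA.
  - by move=> *; rewrite addrC.
  - by move=> t; rewrite linear0 add0r.
  - by move=> t; rewrite linear0 scaleN1r addNr.
  - by move=> *; rewrite scalerA.
  - by move=> *; rewrite scale1r.
  - by move=> *; rewrite scalerDr.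
  - by move=> *; rewrite scalerDl.
  - by move=> *; rewrite linearP.
  - move=> K f c x y KK_K lf IH.
    by have [|lP _ _] := ev_extP K f KK_K lf; [by move=> *; exact: IH|exact: lP].
  - move=> K f x KK_K lf IH Kx.
    by have [|_ _ /(_ x Kx)] := ev_extP K f KK_K lf; first by move=> *; exact: IH.
have ev_cr t : ev (cr (cl t)) = ev t by apply/evP/crP.
have ls : linear (ev \o cr).
  move=> c; elim/cl_ind=> s; elim/cl_ind=> t.
  by rewrite -cl_scaleE -cl_addE /= !ev_cr.
exists (lin_of ls); split=> [v|n] /=; first by rewrite evK crK.
by rewrite ev_cr.
Qed.

End Cells.

Section SmallObject.
Variables (R : pzRingType) (F : lmodType R) (KK : set (set F)).
Hypotheses (projF : projective F) (subKK : forall K, KK K -> submod K).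

(** As F is projective, this says Ext^1(F/K, Z) = 0 for all K in KK. *)
Definition extends_kernels (Z : lmodType R) := forall K (h : F -> Z), KK K -> linear_on K h ->
  exists g : {linear F -> Z}, forall x, K x -> g x = h x.

Lemma extends_kernels_ker (Z E M : lmodType R) (i : {linear Z -> E}) (p : {linear E -> M}) :
  extends_kernels Z -> injective i -> (forall x, p x = 0 <-> exists z, i z = x) ->
  forall K (h : F -> E), KK K -> linear_on K h -> (forall x, K x -> p (h x) = 0) ->
     exists g : {linear F -> E}, forall x, p (g x) = 0 /\ (K x -> g x = h x).
Proof.
move=> extZ ii ker_p K h KK_K lh ph0.
have /choice[h' h'E] x : exists z, K x -> i z = h x.
  case: (pselect (K x)) => [Kx|]; last by exists 0.
  by have [/(_ (ph0 x Kx))[z zE] _] := ker_p (h x); exists z.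
have [||g gE] := extZ K h' => //.
  move=> c x y Kx Ky; apply: ii; rewrite linearP !h'E ?lh //.
  exact: (subKK KK_K).2.
exists (i \o g : {linear F -> E}) => x /=; split; first by apply/ker_p; exists (g x).
by move=> Kx; rewrite gE // h'E.
Qed.

(** [cellmod_section] is used twice. A section of [V * Z0 -> V] sending i n to (i n, j n) shows that
    i is injective because j is. For the cokernel U, an extension of U by Z is pulled back to V and
    split there by a section that descends to U. *)
Theorem small_object (N Z0 : lmodType R) (j : {linear N -> Z0}) :
  injective j -> extends_kernels Z0 ->
  exists (V U : lmodType R) (i : {linear N -> V}) (p : {linear V -> U}),
    [/\ short_exact i p, extends_kernels V & forall Z, extends_kernels Z -> extends U Z].
Proof.
move=> ij ext0; pose V : lmodType R := cellmod KK N.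
pose i : {linear N -> V} := cbase KK N.
pose I : set V := fun v => exists n, i n = v.
have sI : submod I.
  split=> [|c x y [n <-] [m <-]]; first by exists 0; rewrite linear0.
  by exists (c *: n + m); rewrite linearP.
have extV : extends_kernels V by move=> K h; exact: cellmod_extends.
exists V, (quotmod I), i, (qpi I); split=> //.
- split; [|exact: qpi_surj|by move=> x; exact: qpi_eq0].
  pose p : {linear (V * Z0)%type -> V} := fst.
  have lu : linear (fun n => (i n, j n)) by move=> c n m; rewrite !linearP.
  have lz : linear (fun z => (0 : V, z : Z0)).
    by move=> c z w; congr (_, _); rewrite /= scaler0 addr0.
  have [|//||s [sK sE]] := cellmod_section (p := p) (u := lin_of lu) projF _ _ subKK.
  + by move=> v; exists (v, 0).
  + apply: (extends_kernels_ker (i := lin_of lz) ext0); first by move=> z w [].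
    move=> [v z]; split=> [/= ->|[w [<- _]]//]; by exists z.
  move=> n m nm; apply: ij; have := sE n; rewrite -/i nm => e.
  have : lin_of lu n = lin_of lu m by rewrite -[LHS]sE -/i nm; exact: sE.
  by case.
- move=> Z extZ; apply: extends_of_split => E p k sp ik ker_p.
  (* E' is the pullback of E along V -> V/I. The section over V is required to send i n to (0, i n),
     so its first component kills I and factors through the quotient. *)
  pose d := (p \o fst) \- (qpi I \o snd) : {linear (E * V)%type -> quotmod I}.
  pose E' : lmodType R := kermod d.
  pose p' : {linear E' -> V} := snd \o (val : {linear E' -> _}).
  have dE (x : E') : p (val x).1 = qpi I (val x).2.
    by apply/eqP; rewrite -subr_eq0; apply/eqP; exact: (ker_val x).
  have [||u uE] := @ker_corestrict _ _ _ _ d (fun n => (0, i n)).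
  + by move=> c n m; rewrite linearP; congr (_, _); rewrite /= scaler0 addr0.
  + move=> n; rewrite /d /= linear0 sub0r; apply/eqP; rewrite oppr_eq0; apply/eqP.
    by apply/qpi_eq0 => //; exists n.
  have [||z zE] := @ker_corestrict _ _ _ _ d (fun z => (k z, 0)).
  + by move=> c n m; rewrite linearP; congr (_, _); rewrite /= scaler0 addr0.
  + by move=> w; rewrite /d /= linear0 subr0; apply/ker_p; exists w.
  have [|||s [sK sE]] := cellmod_section (p := p') (u := u) projF _ _ subKK.
  + move=> v; have [e eE] := sp (qpi I v).
    have kx : ker_pred d (e, v) by apply/eqP; rewrite /d /= eE subrr.
    by exists (exist _ (e, v) kx).
  + by move=> n; rewrite /p' /= uE.
  + apply: (extends_kernels_ker (i := z) extZ).
      by move=> x y xy; apply: ik; have := congr1 val xy; rewrite !zE; case.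
    move=> x; split; last by move=> [w <-]; rewrite /p' /= zE.
    rewrite /p' /= => x20; have := dE x; rewrite x20 linear0 => /ker_p[w wE].
    by exists w; apply: val_inj; rewrite zE wE -x20 [RHS]surjective_pairing.
  pose e v := (val (s v)).1.
  have le : linear e by move=> c v w; rewrite /e !linearP.
  have [|g gE] := surj_factor (@qpi_surj _ _ I) le.
    by move=> v /(qpi_eq0 _ sI)[n <-]; rewrite /e sE uE.
  exists g => y; have [v <-] := @qpi_surj _ _ I y.
  by rewrite gE dE -[X in _ = qpi I X]sK.
Qed.
End SmallObject.

(** * Tensor products and Hom *)

Section TensorLift.
Variable k : comPzRingType.

Lemma tensor_lift (M N V : lmodType k) (b : M -> N -> V) :
  (forall y, linear (b^~ y)) -> (forall x, linear (b x)) ->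
  exists f : {linear tensor M N -> V}, forall x y, f (tens x y) = b x y.
Proof.
move=> bl br; pose F := free_ext (fun z : M * N => b z.1 z.2).
have FE x y : F (basis k (x, y)) = b x y by rewrite /F free_ext_basis.
have bDl x x' y : b (x + x') y = b x y + b x' y.
  exact: (linearD (lin_of (bl y))).
have bDr x y y' : b x (y + y') = b x y + b x y' by exact: (linearD (lin_of (br x))).
have bZl c x y : b (c *: x) y = c *: b x y.
  by rewrite -[LHS]/(lin_of (bl y) _) linearZ.
have bZr c x y : b x (c *: y) = c *: b x y.
  by rewrite -[LHS]/(lin_of (br x) _) linearZ.
have Frel v : v \in span (@tensor_rel k M N) -> F v = 0.
  move=> /asboolP /(_ (ker_pred F) (ker_closed F)) vF; apply/eqP/vF => {vF}{}v.
  rewrite unfold_in; case.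
  - by move=> [x [x' [y ->]]]; rewrite !linearB /= !free_ext_basis /= bDl addrAC addrK subrr.
  - by move=> [x [y [y' ->]]]; rewrite !linearB /= !free_ext_basis /= bDr addrAC addrK subrr.
  - by move=> [c [x [y ->]]]; rewrite linearB linearZ /= !free_ext_basis /= bZl subrr.
  - by move=> [c [x [y ->]]]; rewrite linearB linearZ /= !free_ext_basis /= bZr subrr.
have [lF FK] := quot_lift_linear Frel.
by exists (lin_of lF) => x y; rewrite -FE; exact: FK.
Qed.

Lemma tensor_seq (M N : lmodType k) (t : tensor M N) :
  exists r : seq (M * N), t = \sum_(z <- r) tens z.1 z.2.
Proof.
rewrite -(qreprK t) -[qrepr t]free_ext_id /free_ext linear_sum.
set v := qrepr t; exists [seq (v z *: z.1, z.2) | z <- finsupp v].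
rewrite big_map; apply: eq_bigr => -[x y] _.
by rewrite linearZ /= tensZl.
Qed.

(** Projectivity gives a dual basis: if [s] splits the free cover of X, the y-coordinate of [s]
    induces maps c_y from L tensor X to L, natural in L, and t is the sum of the tens (c_y t) y. If
    t dies under j, then j (c_y t) = 0 for all y, hence c_y t = 0 and t = 0. *)
Lemma tensor_map_inj (M M' X : lmodType k) (j : {linear M' -> M}) :
  projective X -> injective j -> injective (tensor_map j (@id X)).
Proof.
move=> projX ij.
have [s sK] := projX _ _ (free_cover X) idfun (@free_cover_surj _ X).
have coord (L : lmodType k) (y : X) :
    exists c : {linear tensor L X -> L}, forall m x, c (tens m x) = (s x : freemod k X) y *: m.
  apply: tensor_lift => [x|m] a u v; first by rewrite scalerDr !scalerA mulrC.
  by rewrite linearP fmD fmZ scalerDl scalerA.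
have lj : linear (tensor_map j (@id X)).
  by apply: tensor_map_linear => // c x y; rewrite linearP.
suff ker0 t : tensor_map j (@id X) t = 0 -> t = 0.
  move=> t u tu; apply/eqP; rewrite -subr_eq0; apply/eqP/ker0.
  by rewrite -[tensor_map j _ _]/(lin_of lj _) linearB /= tu subrr.
move=> jt0.
have c0 y (c : {linear tensor M' X -> M'}) :
    (forall m x, c (tens m x) = (s x : freemod k X) y *: m) -> c t = 0.
  move=> cE; apply: ij; rewrite linear0.
  have [c' c'E] := coord M y.
  have -> : j (c t) = c' (tensor_map j (@id X) t); last by rewrite jt0 linear0.
  apply: (@tensor_linear_eq _ _ _ _ (j \o c) (c' \o lin_of lj)) => [a u v|a u v|m x].
  - by rewrite linearP.
  - by rewrite linearP.
  - rewrite /= cE linearZ /= tensor_mapE ?c'E // => a u v.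
    by rewrite linearP.
have [r rE] := tensor_seq t.
pose S := (\bigcup_(z <- r) finsupp (s z.2 : freemod k X))%fset.
have -> : t = \sum_(y <- S) tens (\sum_(z <- r) (s z.2 : freemod k X) y *: z.1) y.
  transitivity (\sum_(y <- S) \sum_(z <- r) tens ((s z.2 : freemod k X) y *: z.1) y).
    rewrite exchange_big {1}rE /= big_seq [RHS]big_seq; apply: eq_bigr => -[m x] zr /=.
    rewrite -{1}[x]sK /= (@free_extE _ _ _ _ _ S); last exact: (bigfcup_sup _ zr).
    elim/big_ind2: _ => [|u u' v v' <- <-|y _].
    - by rewrite -[0 in LHS](scale0r (0 : X)) tensZr scale0r.
    - exact: tensDr.
    - by rewrite tensZr tensZl.
  apply: eq_bigr => y _; elim/big_ind2: _ => [|u u' v v' -> ->|//].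
    by rewrite -[X in tens X _](scale0r (0 : M')) tensZl scale0r.
  by rewrite tensDl.
apply: big1 => y _; have [c cE] := coord M' y.
have -> : \sum_(z <- r) (s z.2 : freemod k X) y *: z.1 = c t.
  by rewrite rE linear_sum; apply: eq_bigr => z _; rewrite cE.
by rewrite (c0 y c cE) -[X in tens X _](scale0r (0 : M')) tensZl scale0r.
Qed.

End TensorLift.

(** * Hom_k with the conjugation action, and its adjunction with the diagonal tensor product *)

Section GroupModules.
Variables (k : comPzRingType) (G : groupType).
Local Notation kG := (grpring k G).

Lemma scale_grpring_linear (M : lmodType kG) (x : M) :
  linear ((fun a : kG => a *: x) : freemod k G -> resk M).
Proof.
move=> c a b.
rewrite -[RHS]/((c *: (1 : kG)) *: ((a : kG) *: x) + (b : kG) *: x).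
by rewrite scalerA grpring_scalel mul1r -scalerDl.
Qed.

Lemma grp_linear (M N : lmodType kG) (f : M -> N) :
  linear (f : resk M -> resk N) ->
  (forall g x, f (gdelta k g *: x) = gdelta k g *: f x) -> linear f.
Proof.
move=> lf fg; have fZ (a : kG) (x : M) : f (a *: x) = a *: f x.
  move: a; apply: (@free_linear_eq k G (resk N)
    (fun a : kG => f (a *: x) : resk N) (fun a : kG => a *: f x : resk N)) => [c a b||g].
  - by rewrite (scale_grpring_linear x c a b) lf.
  - exact: scale_grpring_linear.
  - exact: fg.
by move=> a x y; rewrite -fZ; exact: (linearD (lin_of lf)).
Qed.

Lemma grp_linear_res (M N : lmodType kG) (f : {linear M -> N}) :
  linear (f : resk M -> resk N).
Proof. by move=> c x y; exact: linearP. Qed.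

Definition resk_lin (M N : lmodType kG) (f : {linear M -> N}) :
  {linear resk M -> resk N} := lin_of (grp_linear_res f).

(** The carriers of [resk (repmod r)] and V are convertible, but the scaling of the former passes
    through multiples of 1 in kG; this equation mediates each passage between the two. *)
Lemma repmod_scale (V : lmodType k) (r : grep G V) c (v : V) :
  (c *: (v : resk (repmod r)) : V) = c *: v.
Proof.
rewrite -[LHS]/(rm_scale (r := r) (c *: (1 : kG)) v).
by rewrite /rm_scale linearZ /= -gdelta1 -[free_ext _ _]/(rm_scale (r := r) _ v) rm_scale_delta gact1.
Qed.

Lemma linear_to_rep (V : lmodType k) (r : grep G V) (N : lmodType kG) (f : N -> V) :
  linear (f : resk N -> V) ->
  (forall g x, f (gdelta k g *: x) = gact r g (f x)) -> linear (f : N -> repmod r).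
Proof.
move=> lf fg; apply: grp_linear => [c x y|g x]; last by rewrite repmod_gdelta; exact: fg.
by rewrite repmod_scale; exact: lf.
Qed.

Lemma linear_of_rep (V : lmodType k) (r : grep G V) (N : lmodType kG) (f : V -> N) :
  linear (f : V -> resk N) ->
  (forall g x, f (gact r g x) = gdelta k g *: f x) -> linear (f : repmod r -> N).
Proof.
move=> lf fg; apply: grp_linear => [c x y|g x]; last by rewrite repmod_gdelta; exact: fg.
by rewrite repmod_scale; exact: lf.
Qed.

Lemma rep_linear (V : lmodType k) (r : grep G V) (N : lmodType kG)
  (f : {linear repmod r -> N}) :
  linear (f : V -> resk N).
Proof. by move=> c x y; rewrite -(repmod_scale r); exact: (linearP (resk_lin f)). Qed.

Lemma to_rep_linear (V : lmodType k) (r : grep G V) (N : lmodType kG)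
  (f : {linear N -> repmod r}) :
  linear (f : resk N -> V).
Proof.
by move=> c x y; have := linearP (resk_lin f) c x y; by rewrite /= (repmod_scale r).
Qed.

Section Hom.
Variables X Z : lmodType kG.

Definition hom_pred : {pred (resk X -> resk Z)} := fun f => `[< linear f >].

Fact hom_closed : GRing.subsemimod_closed hom_pred.
Proof.
split; [split|].
- by apply/asboolP => c x y; rewrite [RHS]addr0 scaler0.
- move=> f g /asboolP lf /asboolP lg; apply/asboolP => c x y.
  by rewrite -[LHS]/(f _ + g _) lf lg -[(f + g) x]/(f x + g x) scalerDr addrACA.
- move=> d f /asboolP lf; apply/asboolP => c x y.
  rewrite -[LHS]/(d *: f _) lf -[(d *: f) x]/(d *: f x) scalerDr !scalerA.
  by rewrite mulrC.
Qed.
HB.instance Definition _ :=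
  GRing.isSubmodClosed.Build k (resk X -> resk Z) hom_pred hom_closed.

Definition homk : Type := {f : resk X -> resk Z | hom_pred f}.
HB.instance Definition _ := SubChoice.on homk.
HB.instance Definition _ := [SubChoice_isSubLmodule of homk by <:].

Fact hom_act_subproof (g : G) (h : homk) :
  hom_pred (fun x => res_act g (val h (res_act g^-1%g x))).
Proof.
by have /asboolP lh := valP h; apply/asboolP => c x y; rewrite res_act_linear lh res_act_linear.
Qed.

Definition hom_act (g : G) (h : homk) : homk :=
  exist (fun f => hom_pred f) _ (hom_act_subproof g h).

Fact hom_act_linear g : linear (hom_act g).
Proof.
move=> c u v; apply/val_inj/funext => x /=; exact: res_act_linear.
Qed.
Fact hom_act1 h : hom_act 1%g h = h.
Proof. by apply/val_inj/funext => x /=; rewrite invg1 !res_act1. Qed.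
Fact hom_actM g g' h : hom_act (g * g')%g h = hom_act g (hom_act g' h).
Proof. by apply/val_inj/funext => x /=; rewrite invgM !res_actM. Qed.

Definition homM : lmodType kG := repmod (Grep hom_act_linear hom_act1 hom_actM).

Definition hfun (h : homM) : X -> Z := val (h : homk).

Lemma hfun_inj h h' : (forall x, hfun h x = hfun h' x) -> h = h'.
Proof. by move=> hh'; apply/val_inj/funext => x; exact: hh'. Qed.

Lemma hfun_linear h : linear (hfun h : resk X -> resk Z).
Proof. by apply/asboolP; exact: valP (h : homk). Qed.

Lemma hfun0 x : hfun 0 x = 0. Proof. by []. Qed.

Lemma hom_of (f : resk X -> resk Z) : linear f -> exists h : homM, hfun h = f.
Proof.
by move=> /asboolP lf; exists (exist (fun f => hom_pred f) f lf : homk).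
Qed.

Lemma linear_to_hom (M : lmodType kG) (f : M -> homM) :
  (forall x, linear (fun m : resk M => hfun (f m) x : resk Z)) ->
  (forall g m x, hfun (f (gdelta k g *: m)) x
     = gdelta k g *: hfun (f m) (gdelta k g^-1%g *: x)) -> linear f.
Proof.
move=> lf fg; apply: linear_to_rep => [c m m'|g m]; apply/val_inj/funext => x.
  exact: lf.
exact: fg.
Qed.

Lemma hom_linear (M : lmodType kG) (f : {linear M -> homM}) x :
  linear (fun m : resk M => hfun (f m) x : resk Z).
Proof.
move=> c m m'; have /(congr1 (fun h : homk => val h x)) := to_rep_linear f c m m'.
by [].
Qed.

Lemma hom_equivariant (M : lmodType kG) (f : {linear M -> homM}) g m x :
  hfun (f (gdelta k g *: m)) x = gdelta k g *: hfun (f m) (gdelta k g^-1%g *: x).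
Proof.
have -> : f (gdelta k g *: m) = gdelta k g *: f m by rewrite linearZ.
by rewrite [gdelta k g *: f m]repmod_gdelta.
Qed.

End Hom.

Section Adjunction.
Variables M X Z : lmodType kG.

Lemma curry (f : {linear diag_tensor M X -> Z}) :
  exists h : {linear M -> homM X Z},
    forall m x, hfun (h m) x = f (tens (m : resk M) (x : resk X)).
Proof.
have lf := rep_linear f.
have lfr (m : M) : linear (fun x : resk X => f (tens (m : resk M) x) : resk Z).
  by move=> c x y; rewrite tensDr tensZr lf.
have /choice[h hE] m := hom_of (lfr m).
have lh : linear h.
  apply: linear_to_hom => [x c m m'|g m x]; rewrite !hE.
    by rewrite tensDl tensZl lf.
  rewrite -linearZ; congr (f _); rewrite diag_tensor_gdelta; congr tens.
  by rewrite scalerA gdeltaM mulgV gdelta1 scale1r.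
by exists (lin_of lh) => m x; rewrite /= hE.
Qed.

Lemma uncurry (h : {linear M -> homM X Z}) :
  exists f : {linear diag_tensor M X -> Z},
    forall m x, f (tens (m : resk M) (x : resk X)) = hfun (h m) x.
Proof.
have [f fE] := @tensor_lift k (resk M) (resk X) (resk Z) (fun m x => hfun (h m) x)
  (hom_linear h) (fun m => hfun_linear (h m)).
have lf : linear (f : diag_tensor M X -> Z).
  apply: linear_of_rep => [|g t]; first exact: linearP.
  move: t; apply: (@tensor_linear_eq k _ _ (resk Z) (fun t => f (diag_act g t))
    (fun t => res_act g (f t))) => [c s t|c s t|m x].
  - by rewrite diag_act_linear linearP.
  - by rewrite linearP res_act_linear.
  - rewrite diag_actE !fE /res_act hom_equivariant scalerA gdeltaM mulVg.
    by rewrite gdelta1 scale1r.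
by exists (lin_of lf).
Qed.

Lemma diag_linear_eq (f f' : {linear diag_tensor M X -> Z}) :
  (forall m x, f (tens (m : resk M) (x : resk X)) = f' (tens (m : resk M) (x : resk X))) ->
  f =1 f'.
Proof. exact: (tensor_linear_eq (rep_linear f) (rep_linear f')). Qed.
End Adjunction.

Lemma tens_map (M M' X : lmodType kG) (f : {linear M -> M'}) :
  exists F : {linear diag_tensor M X -> diag_tensor M' X},
    (forall m x, F (tens (m : resk M) (x : resk X)) = tens (f m : resk M') x) /\
    (projective (resk X) -> injective f -> injective F).
Proof.
pose fr : resk M -> resk M' := f; have lfr : linear fr := grp_linear_res f.
have lid : linear (@id (resk X)) by [].
have lF : linear (tensor_map fr (@id (resk X)) : diag_tensor M X -> diag_tensor M' X).
  apply: (linear_of_rep (N := diag_tensor M' X)) => [c s t|g t].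
    by rewrite (tensor_map_linear lfr lid) -(repmod_scale (Grep (@diag_act_linear k G M' X) (@diag_act1 k G M' X) (@diag_actM k G M' X))).
  rewrite repmod_gdelta /=; move: t; apply: tensor_linear_eq => [c s t|c s t|m x].
  - by rewrite diag_act_linear tensor_map_linear.
  - by rewrite tensor_map_linear // diag_act_linear.
  - rewrite tensor_mapE // !diag_actE tensor_mapE //; congr tens.
    by rewrite /res_act /fr linearZ.
exists (lin_of lF); split=> [m x|pX ij] /=; first exact: tensor_mapE.
exact: (@tensor_map_inj k (resk M') (resk M) (resk X) (lin_of lfr)).
Qed.

Lemma hom_postcomp (X Y Z : lmodType kG) (p : {linear Y -> Z}) :
  exists P : {linear homM X Y -> homM X Z},
    (forall h x, hfun (P h) x = p (hfun h x)) /\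
    (projective (resk X) -> surj p -> surj P).
Proof.
have lc (h : homM X Y) : linear (fun x : resk X => p (hfun h x) : resk Z).
  by move=> c x y; rewrite hfun_linear; exact: (grp_linear_res p).
have /choice[P PE] h := hom_of (lc h).
have lP : linear P.
  apply: linear_to_hom => [x c h h'|g h x]; rewrite !PE.
    rewrite -(grp_linear_res p); congr (p _).
    by have := @hom_linear X Y _ (idfun : {linear homM X Y -> homM X Y}) x c h h'.
  rewrite -linearZ; congr (p _).
  exact: (@hom_equivariant X Y _ (idfun : {linear homM X Y -> homM X Y})).
exists (lin_of lP); split=> [h x|pX sp h] /=; first by rewrite PE.
have [f fE] := pX _ _ (resk_lin p) (lin_of (hfun_linear h)) sp.
have [h' h'E] := @hom_of X Y f (fun c x y => linearP f c x y).
by exists h'; apply: hfun_inj => x; rewrite PE h'E; exact: fE.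
Qed.

End GroupModules.

(** * Tensoring with a k-projective module *)

Section FlatTensor.
Variables (k : comPzRingType) (G : groupType).
Local Notation kG := (grpring k G).
Variable X : lmodType kG.
Hypothesis projX : projective (resk X).

(** Hom(P tensor X, -) is Hom(P, -) after Hom_k(X, -), and both preserve surjections. *)
Lemma projective_diag_tensor (P : lmodType kG) :
  projective P -> projective (diag_tensor P X).
Proof.
move=> projP Y Z p f sp; have [h hE] := curry f.
have [q [qE sq]] := hom_postcomp X p.
have [g gE] := projP _ _ q h (sq projX sp).
have [l lE] := uncurry g; exists l.
apply: (diag_linear_eq (f := p \o l)) => m x /=.
by rewrite lE -qE gE hE.
Qed.

(** Right exactness of a left adjoint: the projection modulo the image of [I] curries to a map
    killing the image of [i], which factors through [q]; uncurrying makes the projection factor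
    through [Q]. *)
Lemma tens_exact (K F M : lmodType kG) (i : {linear K -> F}) (q : {linear F -> M})
    (I : {linear diag_tensor K X -> diag_tensor F X})
    (Q : {linear diag_tensor F X -> diag_tensor M X}) :
  surj q -> (forall x, q x = 0 <-> exists y, i y = x) ->
  (forall m x, I (tens (m : resk K) (x : resk X)) = tens (i m : resk F) x) ->
  (forall m x, Q (tens (m : resk F) (x : resk X)) = tens (q m : resk M) x) ->
  forall t, Q t = 0 <-> exists s, I s = t.
Proof.
move=> sq qi IE QE t; split; last first.
  move=> [s <-]; apply: (diag_linear_eq (f := Q \o I) (f' := \0)) => m x /=.
  rewrite IE QE (_ : q (i m) = 0); last by apply/qi; exists m.
  by rewrite -[X in tens X _](scale0r (0 : resk M)) tensZl scale0r.
pose S : set (diag_tensor F X) := fun t => exists s, I s = t.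
have sS : submod S.
  split=> [|c x y [s <-] [s' <-]]; first by exists 0; rewrite linear0.
  by exists (c *: s + s'); rewrite linearP.
have [h hE] := curry (qpi S).
have [|g gE] := surj_factor sq (linearP h).
  move=> y /qi[z <-]; apply: hfun_inj => x; rewrite hE hfun0.
  by apply/qpi_eq0 => //; exists (tens (z : resk K) (x : resk X)).
have [l lE] := uncurry g.
have lQ : l \o Q =1 qpi S.
  apply: (diag_linear_eq (f := l \o Q)) => m x /=.
  by rewrite QE lE gE hE.
by move=> Qt; apply/(qpi_eq0 _ sS); rewrite -lQ /= Qt linear0.
Qed.

(** The tensored sequence is exact with [I] injective, and it splits because its last term is
    projective: [g] extends the inverse of [I] from ker Q to the middle term. *)
Lemma tens_ker_retract (F M : lmodType kG) (q : {linear F -> M}) :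
  surj q -> projective (diag_tensor M X) ->
  exists (I : {linear diag_tensor (kermod q) X -> diag_tensor F X})
         (g : {linear diag_tensor F X -> diag_tensor (kermod q) X}),
    (forall m x, I (tens (m : resk (kermod q)) (x : resk X)) = tens (val m : resk F) x) /\
    cancel I g.
Proof.
move=> sq projM; pose i : {linear kermod q -> F} := val.
have [I [IE Iinj]] := tens_map X i; have [Q [QE _]] := tens_map X q.
have {}Iinj : injective I by apply: Iinj => //; exact: val_inj.
have qi x : q x = 0 <-> exists y, i y = x.
  split=> [/eqP qx|[y <-]]; last exact: ker_val.
  by exists (exist (fun x => ker_pred q x) x qx).
have exIQ := tens_exact sq qi IE QE.
have sQ : surj Q.
  move=> t; have [r ->] := tensor_seq t; elim/big_rec: _ => [|[m x] u _ [v <-]].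
    by exists 0; rewrite linear0.
  have [y <-] := sq m; exists ((tens (y : resk F) x : diag_tensor F X) + v).
  by rewrite linearD QE.
have /choice[s sE] t : exists u, Q t = 0 -> I u = t.
  by case: (pselect (Q t = 0)) => [/exIQ[u]|]; [exists u|exists 0].
have ls : linear_on (lker Q) s.
  move=> c x y Qx Qy /=; apply: Iinj.
  by rewrite linearP !sE //; exact: (lker_submod Q).2.
have [g gE] := projective_extends projM sQ ls.
exists I, g; split=> // t; have Qt : Q (I t) = 0 by apply/exIQ; exists t.
by rewrite gE //; apply: Iinj; rewrite sE.
Qed.

(** A map from ker q to Hom_k(X, Z) is uncurried, extended along the retraction [g], and curried
    back. *)
Lemma extends_hom (M Z : lmodType kG) :
  projective (diag_tensor M X) -> extends M (homM X Z).
Proof.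
move=> projM F q sq h lh; have [I [g [IE gK]]] := tens_ker_retract sq projM.
pose i : {linear kermod q -> F} := val.
have lhi : linear (h \o i).
  by move=> c x y; rewrite -[LHS]/(h (i (c *: x + y))) linearP lh //; apply: ker_val.
have [f fE] := uncurry (lin_of lhi).
have [l lE] := curry (f \o g); exists l => m /eqP qm; apply: hfun_inj => x.
pose m' : kermod q := exist (fun x => ker_pred q x) m qm.
by rewrite lE /= -[tens _ _](IE m') gK fE.
Qed.

(** Lifting [f] through [p] means lifting its curried form [h] through Hom(X, Y) -> Hom(X, Z). That
    map is onto since X is k-projective, and its kernel Hom(X, ker p) is again of the form to which
    the hypothesis applies. *)
Lemma diag_projective_of_extends (M : lmodType kG) :
  (forall Z, extends M (homM X Z)) -> projective (diag_tensor M X).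
Proof.
move=> ext Y Z p f sp; have [h hE] := curry f.
have [P [PE sP]] := hom_postcomp X p; have {}sP := sP projX sp.
pose A := kermod p; have [J [JE _]] := hom_postcomp X (val : {linear A -> Y}).
(* The pullback of P along h is an extension of M by Hom(X, A). *)
pose d := (P \o fst) \- (h \o snd) : {linear (homM X Y * M)%type -> homM X Z}.
pose q : {linear kermod d -> M} := snd \o (val : {linear kermod d -> _}).
have dE (x : kermod d) : P (val x).1 = h (val x).2.
  by apply/eqP; rewrite -subr_eq0; apply/eqP; exact: (ker_val x).
have Jinj : injective J.
  move=> a b ab; apply: hfun_inj => x; apply: val_inj.
  by have /(congr1 (fun h => hfun h x)) := ab; rewrite !JE.
have PJ u : P u = 0 -> exists a, J a = u.
  move=> Pu; have ux x : ker_pred p (hfun u x) by apply/eqP; rewrite -PE Pu hfun0.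
  have [|a aE] := @hom_of k G X A (fun x => exist (fun y => ker_pred p y) (hfun u x) (ux x)).
    by move=> c x y; apply: val_inj => /=; exact: hfun_linear.
  by exists a; apply: hfun_inj => x; rewrite JE aE.
have sq : surj q.
  move=> m; have [u uE] := sP (h m).
  have ku : ker_pred d (u, m) by apply/eqP; rewrite /d /= uE subrr.
  by exists (exist _ (u, m) ku).
have /choice[r rE] (x : kermod d) : exists a, q x = 0 -> J a = (val x).1.
  case: (pselect (q x = 0)) => [qx|]; last by exists 0.
  have [|a aE] := PJ (val x).1; last by exists a.
  by rewrite dE -[(val x).2]/(q x) qx linear0.
have [|g gE] := ext A _ q sq r.
  move=> c x y qx qy; apply: Jinj; rewrite linearP !rE ?linearP //.
  exact: (lker_submod q).2.
pose s x := (val x).1 - J (g x).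
have ls : linear s.
  move=> c x y; rewrite /s (linearP g) (linearP J).
  by rewrite [val _]linearP scalerBr opprD addrACA.
have [|l lE] := surj_factor sq ls.
  by move=> x qx; rewrite /s gE // rE // subrr.
have [l' l'E] := uncurry l; exists l'.
apply: (diag_linear_eq (f := p \o l')) => m x /=.
rewrite l'E -PE; have [y <-] := sq m; rewrite lE /s linearB dE.
have -> : P (J (g y)) = 0 by apply: hfun_inj => z; rewrite PE JE ker_val hfun0.
by rewrite subr0 hE.
Qed.

(** The tensor product with ker q is a retract of the projective module F tensor X. This makes
    syzygies of cofibrant modules cofibrant. *)
Lemma diag_projective_ker (F M : lmodType kG) (q : {linear F -> M}) :
  surj q -> projective F -> projective (diag_tensor M X) ->
  projective (diag_tensor (kermod q) X).
Proof.
move=> sq projF projM Y Z p f sp; have [I [g [_ gK]]] := tens_ker_retract sq projM.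
have [h hE] := projective_diag_tensor projF (f \o g) sp.
by exists (h \o I) => t /=; rewrite hE /= gK.
Qed.

End FlatTensor.

Lemma extends_retract (R : pzRingType) (M N N' : lmodType R)
    (i : {linear N -> N'}) (r : {linear N' -> N}) :
  cancel i r -> extends M N' -> extends M N.
Proof.
move=> iK ext P p sp f lf; have [|g gE] := ext P p sp (i \o f).
  by move=> c x y px py /=; rewrite lf // linearP.
by exists (r \o g) => x px /=; rewrite gE //= iK.
Qed.

(** * The module of finitely valued functions is projective *)

Section Noebeling.
Variables (k : comPzRingType) (G : Type).
Local Notation W := (G -> k^o).
Implicit Types (A D J : set (set G)) (U V Z : set G).

Definition ind U : W := fun x => if `[< U x >] then 1 else 0.

Lemma ind1 U x : U x -> ind U x = 1.
Proof. by rewrite /ind => /asboolT ->. Qed.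
Lemma ind0 U x : ~ U x -> ind U x = 0.
Proof. by rewrite /ind => /asboolF ->. Qed.

Lemma indI U V x : ind (U `&` V) x = ind U x * ind V x.
Proof.
case: (pselect (U x)) => ux; rewrite ?(ind1 ux) ?(ind0 ux) ?mul1r ?mul0r.
  case: (pselect (V x)) => vx; rewrite ?(ind1 vx) ?(ind0 vx).
    by rewrite ind1.
  by rewrite ind0 // => -[].
by rewrite ind0 // => -[].
Qed.

Inductive fspan A : W -> Prop :=
| fspan0 : fspan A 0
| fspanS c U f : A U -> fspan A f -> fspan A (c *: ind U + f).

Lemma fspan_submod A : submod (fspan A : set W).
Proof.
split=> [|c f g Af]; first exact: fspan0.
move: g; elim: Af => {f} [g Ag|d U f AU _ IH g Ag]; first by rewrite scaler0 add0r.
by rewrite scalerDr scalerA -addrA; apply: fspanS => //; exact: IH.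
Qed.

Lemma fspan_indic A U : A U -> fspan A (ind U).
Proof. by move=> AU; rewrite -[ind U]addr0 -[ind U]scale1r; apply: fspanS => //; exact: fspan0. Qed.

Lemma fspan_sub A D f : A `<=` D -> fspan A f -> fspan D f.
Proof. by move=> AD; elim=> [|c U g /AD DU _]; [exact: fspan0|exact: fspanS]. Qed.

Lemma fspan_range A f : fspan A f -> finite_set (range f).
Proof.
elim=> [|c U g _ _ fg].
  by apply: (sub_finite_set (B := [set 0])) => // _ [x _ <-].
apply: (sub_finite_set (B := [set u + v | u in [set 0; c] & v in range g])).
  move=> _ [x _ <-]; exists (c * ind U x); last by exists (g x) => //; exists x.
  by rewrite /ind; case: asboolP => _; rewrite ?mulr1 ?mulr0; [right|left].
exact: finite_image2.
Qed.

Lemma fspan_support J f : J set0 -> (forall U V, J U -> J V -> J (U `|` V)) ->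
  fspan J f -> exists2 U, J U & forall x, ~ U x -> f x = 0.
Proof.
move=> J0 JU; elim=> [|c U g JUU _ [V JV gV]]; first by exists set0.
exists (U `|` V); first exact: JU.
move=> x nx; rewrite -[LHS]/(c * ind U x + g x) ind0 ?mulr0 ?gV ?addr0 //.
  by move=> Vx; apply: nx; right.
by move=> Ux; apply: nx; left.
Qed.

(** Here f is the sum of v times the indicator of its level set at v. The value 0 contributes
    nothing, and its exemption allows [A] to be an ideal, which may well miss the zero set of f. *)
Lemma fspan_of_levels A f : finite_set (range f) ->
  (forall v, v != 0 -> A (f @^-1` [set v])) -> fspan A f.
Proof.
move=> /finite_seqP[s fs] lev.
have [s' us' {}fs] : exists2 s' : seq k^o, uniq s' & range f = [set` s'].
  by exists (undup s); rewrite ?undup_uniq // fs; apply/seteqP; split=> x /=; rewrite mem_undup.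
have -> : f = \sum_(v <- s') v *: ind (f @^-1` [set v]).
  apply/funext => x; rewrite fct_sumE.
  have fx : f x \in s' by have : range f (f x) by [exists x]; rewrite fs.
  rewrite (bigD1_seq (f x)) //= big1 ?addr0 => [|v vfx].
    by rewrite -[RHS]/(f x * ind _ x) ind1 ?mulr1.
  by rewrite -[LHS]/(v * ind _ x) ind0 ?mulr0 // => e; rewrite e eqxx in vfx.
have sA := fspan_submod A; elim/big_ind: _ => //; first exact: sA.1.
  exact: (submodD sA).
move=> v _; have [->|v0] := eqVneq v 0; first by rewrite scale0r; exact: sA.1.
by apply: (submodZ sA); apply/fspan_indic/lev.
Qed.

Inductive galg D : set G -> Prop :=
| galg_gen U : D U -> galg D U
| galg0 : galg D set0
| galgC U : galg D U -> galg D (~` U)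
| galgU U V : galg D U -> galg D V -> galg D (U `|` V).

Lemma galgI D U V : galg D U -> galg D V -> galg D (U `&` V).
Proof.
by move=> DU DV; rewrite -[_ `&` _]setCK setCI; apply/galgC/galgU; apply: galgC.
Qed.

Lemma galgT D : galg D setT.
Proof. by rewrite -setC0; apply/galgC/galg0. Qed.

Lemma galg_sub D D' U : D `<=` D' -> galg D U -> galg D' U.
Proof.
move=> DD'; elim=> [V /DD'|| V _|V V' _ + _].
- exact: galg_gen.
- exact: galg0.
- exact: galgC.
- exact: galgU.
Qed.

Lemma galg_preimage D f (T : set k^o) : fspan (galg D) f -> galg D (f @^-1` T).
Proof.
move=> Df; elim: Df T => [T|c U g DU _ IH T].
  case: (pselect (T 0)) => T0; [have -> : (0 : W) @^-1` T = setT|have -> : (0 : W) @^-1` T = set0].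
  - by apply/seteqP; split.
  - exact: galgT.
  - by apply/seteqP; split.
  - exact: galg0.
have -> : (c *: ind U + g) @^-1` T =
    (U `&` g @^-1` [set v | T (c + v)]) `|` (~` U `&` g @^-1` T).
  apply/seteqP; split=> x.
    rewrite /preimage /= -[(_ + g) x]/(c * ind U x + g x).
    case: (pselect (U x)) => Ux; rewrite ?(ind1 Ux) ?(ind0 Ux) ?mulr1 ?mulr0 ?add0r; by [left|right].
  rewrite /preimage /= -[(_ + g) x]/(c * ind U x + g x).
  by case=> -[Ux]; rewrite ?(ind1 Ux) ?(ind0 Ux) ?mulr1 ?mulr0 ?add0r.
by apply: galgU; apply: galgI => //; apply: galgC.
Qed.

Lemma galg_adjoin D e U : galg (D `|` [set e]) U -> exists U1 U2,
  [/\ galg D U1, galg D U2 & forall x, U x <-> (e x /\ U1 x) \/ (~ e x /\ U2 x)].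
Proof.
elim=> [V [DV|->]|| V _ [U1 [U2 [D1 D2 E]]]|V V' _ [U1 [U2 [D1 D2 E]]] _ [U1' [U2' [D1' D2' E']]]].
- exists V, V; split=> [||x]; [exact: galg_gen|exact: galg_gen|].
  by case: (pselect (e x)); tauto.
- exists setT, set0; split=> [||x]; [exact: galgT|exact: galg0|].
  by split=> [ex|[[]//|[]//]]; left.
- by exists set0, set0; split=> [||x]; [exact: galg0|exact: galg0|rewrite /set0 /=; tauto].
- exists (~` U1), (~` U2); split=> [||x]; [exact: galgC|exact: galgC|].
  rewrite /setC /= E; case: (pselect (e x)); tauto.
- exists (U1 `|` U1'), (U2 `|` U2'); split=> [||x]; [exact: galgU|exact: galgU|].
  rewrite /setU /= E E'; tauto.
Qed.

Lemma fspan_mul D V f : galg D V -> fspan (galg D) f -> fspan (galg D) (ind V * f).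
Proof.
move=> DV; elim=> [|c U g DU _ IH]; first by rewrite mulr0; exact: fspan0.
have -> : ind V * (c *: ind U + g) = c *: ind (V `&` U) + ind V * g.
  apply/funext => x; rewrite -[LHS]/(ind V x * (c * ind U x + g x)).
  by rewrite -[RHS]/(c * ind (V `&` U) x + ind V x * g x) indI mulrDr mulrCA.
by apply: fspanS => //; exact: galgI.
Qed.

Lemma fspan_adjoin D e f : fspan (galg (D `|` [set e])) f ->
  exists a b, [/\ fspan (galg D) a, fspan (galg D) b & f = a + ind e * b].
Proof.
have sA := fspan_submod (galg D).
elim=> [|c U g /galg_adjoin[U1 [U2 [D1 D2 E]]] _ [a [b [Da Db ->]]]].
  by exists 0, 0; rewrite mulr0 addr0; split=> //; exact: sA.1.
exists (c *: ind U2 + a), (c *: (ind U1 - ind U2) + b); split.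
- by apply: sA.2 => //; exact: fspan_indic.
- by apply: sA.2 => //; apply: (submodB sA); exact: fspan_indic.
apply/funext => x.
rewrite -[LHS]/(c * ind U x + (a x + ind e x * b x)).
rewrite -[RHS]/(c * ind U2 x + a x + ind e x * (c * (ind U1 x - ind U2 x) + b x)).
have -> : ind U x = ind U2 x + ind e x * (ind U1 x - ind U2 x).
  case: (pselect (e x)) => ex; rewrite ?(ind1 ex) ?(ind0 ex) ?mul1r ?mul0r.
    rewrite addrC subrK; case: (pselect (U1 x)) => ux; rewrite ?(ind1 ux) ?(ind0 ux).
      by rewrite ind1 // E; tauto.
    by rewrite ind0 // E; tauto.
  rewrite addr0; case: (pselect (U2 x)) => ux; rewrite ?(ind1 ux) ?(ind0 ux).
    by rewrite ind1 // E; tauto.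
  by rewrite ind0 // E; tauto.
move: (ind U1 x - ind U2 x) => d.
by rewrite mulrDr [ind e x * (_ + _)]mulrDr [ind e x * (c * d)]mulrCA addrACA.
Qed.

Definition ideal D J := [/\ J `<=` galg D, J set0,
  forall U V, J U -> galg D V -> V `<=` U -> J V & forall U V, J U -> J V -> J (U `|` V)].

(* Multiplication by [ind e] identifies span (galg D) / span (colon D e J) with the
   subquotient that [galg (D `|` [set e])] adds to [galg D] modulo [J]. *)
Definition colon D e J : set (set G) := fun U => galg D U /\
  exists V Z, [/\ galg D V, J Z & forall x, ~ Z x -> (e x /\ U x <-> V x)].

Lemma colon_ideal D D' e J : ideal D' J -> ideal D (colon D e J).
Proof.
move=> [_ J0 _ JU]; split.
- by move=> U [].
- split; first exact: galg0.
  by exists set0, set0; split=> //; [exact: galg0|move=> x _; rewrite /set0 /=; tauto].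
- move=> U V [DU [U' [Z [DU' JZ E]]]] DV VU; split=> //.
  exists (U' `&` V), Z; split=> //; first exact: galgI.
  by move=> x /E; have := VU x; rewrite /setI /=; tauto.
- move=> U V [DU [U' [Z [DU' JZ E]]]] [DV [V' [Y [DV' JY E']]]]; split; first exact: galgU.
  exists (U' `|` V'), (Z `|` Y); split; [exact: galgU|exact: JU|].
  by move=> x nx; have := E x; have := E' x; move: nx; rewrite /setU /=; tauto.
Qed.

(** Off some Z in J, e * a and b agree, so for each v <> 0 the set e [&] {a = v} coincides with {b =
    v} there; hence {a = v} lies in the colon ideal. Points outside e cause no trouble because b is
    0 at them. *)
Lemma fspan_colon D e J D' a b : ideal D' J ->
  fspan (galg D) a -> fspan (galg D) b -> fspan J (ind e * a - b) -> fspan (colon D e J) a.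
Proof.
move=> [_ J0 _ JU] Da Db /(fspan_support J0 JU)[Z JZ Z0].
apply: fspan_of_levels => [|v v0]; first exact: fspan_range Da.
split; first exact: galg_preimage.
exists (b @^-1` [set v]), Z; split=> //; first exact: galg_preimage.
move=> x /Z0 /eqP; rewrite -[X in X == _]/(ind e x * a x - b x) subr_eq0 => /eqP E.
rewrite /preimage /= -E; case: (pselect (e x)) => ex.
  by rewrite (ind1 ex) mul1r; tauto.
rewrite (ind0 ex) mul0r; split=> [[]//|e0].
by rewrite e0 eqxx in v0.
Qed.

Lemma colon_fspan D e J D' a : ideal D' J -> D `<=` D' -> D' e ->
  fspan (colon D e J) a -> exists2 b, fspan (galg D) b & fspan J (ind e * a - b).
Proof.
move=> [_ J0 Jsub JU] DD' De; have sA := fspan_submod (galg D); have sJ := fspan_submod J.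
elim=> [|c U f [DU [V [Z [DV JZ E]]]] _ [b Db Jb]].
  by exists 0; rewrite ?mulr0 ?subr0; [exact: sA.1|exact: sJ.1].
exists (c *: ind V + b); first by apply: sA.2 => //; exact: fspan_indic.
have -> : ind e * (c *: ind U + f) - (c *: ind V + b) =
    c *: (ind ((e `&` U) `\` V) - ind (V `\` (e `&` U))) + (ind e * f - b).
  apply/funext => x.
  rewrite -[LHS]/(ind e x * (c * ind U x + f x) - (c * ind V x + b x)).
  rewrite -[RHS]/(c * (ind ((e `&` U) `\` V) x - ind (V `\` (e `&` U)) x) + (ind e x * f x - b x)).
  have -> : ind ((e `&` U) `\` V) x - ind (V `\` (e `&` U)) x = ind e x * ind U x - ind V x.
    rewrite -indI; case: (pselect ((e `&` U) x)) => eu; case: (pselect (V x)) => vx.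
    - rewrite (ind1 eu) (ind1 vx) !ind0 ?subrr //; first by case.
      by case.
    - by rewrite (ind1 eu) (ind0 vx) ind1 // ind0 // => -[].
    - by rewrite (ind0 eu) (ind1 vx) ind0 ?ind1 // => -[].
    - by rewrite (ind0 eu) (ind0 vx) !ind0 // => -[].
  by rewrite mulrDr mulrBr mulrCA opprD addrACA.
have DeU : galg D' (e `&` U) by apply: galgI; [exact: galg_gen|exact: galg_sub DU].
have DV' : galg D' V by exact: galg_sub DV.
have JD X Y : galg D' X -> galg D' Y -> (forall x, ~ Z x -> (X x <-> Y x)) -> J (X `\` Y).
  move=> DX DY XY; apply: (Jsub Z) => //; first by apply: galgI => //; exact: galgC.
  by move=> x [Xx nYx]; apply: contrapT => /XY; tauto.
apply: sJ.2 => //; apply: (submodB sJ); apply/fspan_indic/JD => // x nZ.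
by rewrite -(E x nZ).
Qed.

End Noebeling.

Arguments fspan_submod {k G} A.

(** * Well-founded induction along a well-order *)

Section WellOrder.
Variables (T : eqType) (R : rel T).
Hypothesis woR : well_order R.

Definition wlt (x y : T) : Prop := ~ R y x.

Lemma wo_min (A : set T) : A !=set0 -> exists2 m, A m & forall y, A y -> R m y.
Proof.
move=> [x Ax]; have [|m [[/asboolP Am mP] _]] := woR (A := fun x => `[< A x >]).
  by exists x; apply/asboolP.
by exists m => // y Ay; apply/mP/asboolP.
Qed.

Lemma wo_total x y : R x y \/ R y x.
Proof.
have [|m [->|->] mP] := @wo_min [set x; y]; first by exists x; left.
- by left; apply: mP; right.
- by right; apply: mP; left.
Qed.

(** Both points are minima of {x, y}, and [well_order] provides a unique minimum. *)
Lemma wo_anti x y : R x y -> R y x -> x = y.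
Proof.
move=> xy yx; have Rxx z : R z z by case: (wo_total z z).
have [|m [_ mP]] := woR (A := fun z => (z == x) || (z == y)).
  by exists x; rewrite unfold_in eqxx.
rewrite -(mP x) ?(mP y) //; split; rewrite /= ?unfold_in ?eqxx ?orbT //.
  by move=> z /orP[]/eqP->.
by move=> z /orP[]/eqP->.
Qed.

Lemma wlt_trans x y z : wlt x y -> wlt y z -> wlt x z.
Proof.
rewrite /wlt => xy yz zx.
have [|m mA mP] := @wo_min (fun u => [\/ u = x, u = y | u = z]).
  by exists x; constructor 1.
have mx := mP x (Or31 _ _ erefl); have my := mP y (Or32 _ _ erefl); have mz := mP z (Or33 _ _ erefl).
case: mA mx my mz => -> mx my mz; [|exact: xy|exact: yz].
by apply: yz; rewrite (wo_anti zx mz).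
Qed.

Lemma wo_induction (P : T -> Prop) :
  (forall x, (forall y, wlt y x -> P y) -> P x) -> forall x, P x.
Proof.
move=> IH x; apply: contrapT => nPx.
have [|m nPm mP] := @wo_min (fun x => ~ P x); first by exists x.
apply/nPm/IH => y ym; apply: contrapT => nPy; exact/ym/mP.
Qed.

Definition wclosed (D : set T) := forall x y, D y -> wlt x y -> D x.

End WellOrder.

(** * Noebeling's theorem by induction on initial segments of the subsets of G *)

Section NoebelingTheorem.
Variables (k : comPzRingType) (G : Type).
Local Notation W := (G -> k^o).
Variable R : rel (set G).
Hypothesis woR : well_order R.

Lemma mul_ind_linear (U : set G) : linear (fun f : W => ind k U * f).
Proof.
move=> c f g; apply/funext => x.
rewrite -[LHS]/(ind k U x * (c * f x + g x)) -[RHS]/(c * (ind k U x * f x) + ind k U x * g x).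
by rewrite mulrDr mulrCA.
Qed.

(* The quotients of the span of [galg D] by spans of ideals are projective. *)
Definition splits (D : set (set G)) := forall J, ideal D J ->
  forall (E : lmodType k) (p : {linear E -> W}),
  (forall a, fspan (galg D) a -> exists x, fspan J (a - p x)) ->
  exists T, transversal p (fspan J : set W) T /\
    (forall a, fspan (galg D) a -> img p (fspan J : set W) T a).

Lemma galg_chain (F : set (set (set G))) U : F !=set0 -> total_on F subset ->
  galg (\bigcup_(S in F) S) U -> exists2 S, F S & galg S U.
Proof.
move=> [S0 FS0] Ft; elim=> [V [S FS SV]|| V _ [S FS SV]|V V' _ [S FS SV] _ [S' FS' SV']].
- by exists S => //; exact: galg_gen.
- by exists S0 => //; exact: galg0.
- by exists S => //; exact: galgC.
- have [SS|SS] := Ft _ _ FS FS'; [exists S'|exists S] => //; apply: galgU => //.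
    exact: galg_sub SV.
  exact: galg_sub SV'.
Qed.

Lemma fspan_chain (F : set (set (set G))) (f : W) : F !=set0 -> total_on F subset ->
  fspan (galg (\bigcup_(S in F) S)) f -> exists2 S, F S & fspan (galg S) f.
Proof.
move=> F0 Ft; elim=> [|c U g FU _ [S' FS' Sg]].
  by have [S FS] := F0; exists S => //; exact: fspan0.
have [S FS SU] := galg_chain F0 Ft FU.
have [SS|SS] := Ft _ _ FS FS'; [exists S'|exists S] => //; apply: fspanS => //.
  exact: galg_sub SU.
by apply: fspan_sub Sg => V; exact: galg_sub.
Qed.

(* Well-founded induction works because, by [colon], the subquotients of the filtration of
   span (galg D) by initial segments are again quotients of some span (galg {i < j}). *)
Lemma splits_step D : wclosed R D ->
  (forall j, D j -> splits (fun i => wlt R i j)) -> splits D.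
Proof.
move=> cD IH J idJ E p sp; have [Jsub J0 Jdown JU] := idJ.
pose K : set W := fspan J; have sK : submod K := fspan_submod J.
(* If J contains [setT], the quotient is zero. Otherwise no non-zero constant lies in the span of J,
   so the multiples of a preimage x0 of 1 form a transversal for the constants, which are the span
   of [galg set0]. *)
case: (pselect (J setT)) => [JT|nJT].
  exists [set 0]; split.
    by split=> [|x ->//]; split=> // c x y -> ->; rewrite scaler0 addr0.
  move=> a Da; exists 0 => //; rewrite linear0 subr0; apply: fspan_sub Da => U DU.
  exact: (Jdown setT).
pose phi (S : set (set G)) : set W := fun w => exists2 a, fspan (galg S) a & K (w - a).
pose one : W := ind k setT.
have galg_empty U : galg set0 U -> U = set0 \/ U = setT.
  elim=> [//|| V _ [->|->]|V V' _ [->|->] _ [->|->]];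
    rewrite ?setC0 ?setCT ?set0U ?setTU; by [left|right].
have fspan_empty (a : W) : fspan (galg set0) a -> exists c, a = c *: one.
  elim=> [|c U f /galg_empty[]-> _ [d ->]]; first by exists 0; rewrite scale0r.
    exists d; rewrite -[RHS]add0r; congr (_ + _); apply/funext => x.
    by rewrite -[LHS]/(c * ind k set0 x) ind0 ?mulr0.
  by exists (c + d); rewrite scalerDl.
have [x0 x0K] : exists x, K (one - p x) by apply/sp/fspan_indic/galgT.
pose T0 : set E := fun x => exists c, x = c *: x0.
(* The labels are the initial segments S of D, and [phi S] is the span of [galg S] plus that of
   J. *)
have [||||||T [S [tT _ eT DS]]] := @transversal_chain k E W p K (set G)
    (fun S => S `<=` D /\ wclosed R S) phi D T0 set0.
- split.
    split=> [|c _ _ [a ->] [b ->]]; first by exists 0; rewrite scale0r.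
    by exists (c * a + b); rewrite scalerDl scalerA.
  move=> _ [c ->]; rewrite linearZ /= => Kc.
  have : K (c *: one).
    by rewrite -[one](subrK (p x0)) scalerDr; apply: (submodD sK) => //; apply: (submodZ sK).
  move=> /(fspan_support J0 JU)[U JUU cU].
  have [c0|c0] := pselect (c = 0); first by rewrite c0 scale0r.
  have UT : U = setT.
    apply/seteqP; split=> // x _; apply: contrapT => /cU.
    by rewrite -[(_ *: _) x]/(c * one x) /one ind1 ?mulr1.
  by case: nJT; rewrite -UT.
- by split=> [x []|x y []].
- apply/seteqP; split=> w.
    move=> [_ [c ->] Kc]; exists (c *: one).
      by apply: (submodZ (fspan_submod _)); apply/fspan_indic/galgT.
    have -> : w - c *: one = (w - p (c *: x0)) - c *: (one - p x0).
      by rewrite [p (c *: x0)]linearZ /= scalerBr opprB addrA subrK.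
    by apply: (submodB sK) => //; apply: (submodZ sK).
  move=> [_ /fspan_empty[c ->] Kc]; exists (c *: x0); first by exists c.
  have -> : w - p (c *: x0) = (w - c *: one) + c *: (one - p x0).
    by rewrite [p (c *: x0)]linearZ /= scalerBr addrA subrK.
  by apply: (submodD sK) => //; apply: (submodZ sK).
- move=> F F0 Ft FP; split; first split.
  + by move=> x [S FS Sx]; have [SD _] := FP _ FS; exact: SD.
  + move=> x y [S FS Sy] xy; exists S => //; have [_ cS] := FP _ FS.
    exact: cS Sy xy.
  + by move=> w [a Fa Ka]; have [S FS Sa] := fspan_chain F0 Ft Fa; exists S => //; exists a.
- move=> S S' SS w [a Sa Ka]; exists a => //.
  by apply: fspan_sub Sa => V; exact: galg_sub.
- move=> T S tT [SD cS] eT [l Dl nSl].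
  (* With j the least element of D outside S, the segment S is exactly {i < j}, so the induction
     hypothesis for j applies to S. *)
  have [|j [Dj nSj] jmin] := wo_min woR (A := fun i => D i /\ ~ S i); first by exists l.
  have ltj i : wlt R i j <-> S i.
    split=> [ij|Si ji].
      apply: contrapT => nSi; apply/ij/jmin; split=> //; exact: cD ij.
    have [e|ne] := pselect (i = j); first by apply: nSj; rewrite -e.
    by apply: nSj; apply: (cS _ i) => // ij; apply/ne/(wo_anti woR).
  have {}IH : splits S.
    rewrite (_ : S = fun i => wlt R i j); first exact: IH.
    by apply/seteqP; split=> i /ltj.
  pose e := ind k j; have le := mul_ind_linear j; rewrite -/e in le.
  have eS := fspan_submod (k := k) (galg S).
  have SjD : S `|` [set j] `<=` D by move=> i [/SD|->].
  (* The pullback of [p] along multiplication by [e], modulo K; [kermod (qpi SS)] turns this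
     submodule into a module. The induction hypothesis for the colon ideal gives a transversal [T1]
     in it, and T + fst(T1) is the enlarged transversal. *)
  pose SS : set (E * W)%type := fun z => fspan (galg S) z.2 /\ K (p z.1 - e * z.2).
  have sSS : submod SS.
    split; first by split; [exact: eS.1|rewrite linear0 mulr0 subr0; exact: sK.1].
    move=> c z z' [Sz Kz] [Sz' Kz']; split; first exact: eS.2.
    rewrite linearP le opprD addrACA -scalerBr; exact: sK.2.
  pose p' : {linear kermod (qpi SS) -> W} := snd \o (val : {linear kermod (qpi SS) -> _}).
  have SSP (z : kermod (qpi SS)) : SS (val z) by apply/(qpi_eq0 _ sSS)/ker_val.
  have [a Sa|T1 [tT1 T1s]] := IH _ (colon_ideal S j idJ) _ p'.
    have [|x Kx] := sp (e * a).
      apply: fspan_mul; first exact: galg_gen.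
      by apply: fspan_sub Sa => V; exact: galg_sub.
    have kx : ker_pred (qpi SS) (x, a).
      apply/eqP/qpi_eq0 => //; split=> //=.
      by rewrite -opprB; exact: (submodN sK).
    exists (exist _ (x, a) kx); rewrite /p' /= subrr; exact: fspan0.
  pose T' : set E := fun x => exists g y, [/\ T g, T1 y & x = g + (val y).1].
  have KS f : fspan (colon S j J) f -> exists2 b, fspan (galg S) b & K (e * f - b).
    by apply: (colon_fspan idJ) => // i Si; apply: SjD; left.
  exists T', (S `|` [set j]); split; last first.
    split=> [x Tx|x Sx|]; last by exists j => //; right.
      by exists x, 0; split=> //; [exact: tT1.1.1|rewrite linear0 addr0].
    by left.
  split.
  - split.
      split; first by exists 0, 0; split; [exact: tT.1.1|exact: tT1.1.1|rewrite linear0 addr0].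
      move=> c _ _ [g [y [Tg T1y ->]]] [g' [y' [Tg' T1y' ->]]].
      exists (c *: g + g'), (c *: y + y'); split; [exact: tT.1.2|exact: tT1.1.2|].
      by rewrite [val (c *: y + y')]linearP scalerDr addrACA.
    move=> _ [g [y [Tg T1y ->]]]; rewrite linearD => Kgy.
    have [Sy Ky] := SSP y.
    have [a Sa Ka] : phi S (p g) by rewrite -eT; exists g => //; rewrite subrr; exact: sK.1.
    (* Modulo K, e * (val y).2 equals - a, which lies in the span of [galg S]; so (val y).2 lies in
       the span of the colon ideal, which [T1] meets trivially. *)
    have y0 : y = 0.
      apply: tT1.2 => //; apply: (fspan_colon (b := - a) idJ Sy (submodN eS Sa)).
      rewrite opprK; have -> : e * (val y).2 + a =
        (p g + p (val y).1) - (p (val y).1 - e * (val y).2) - (p g - a).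
        rewrite !opprB -addrA addrACA [p g + _]addrCA [p (val y).1 + _]addrCA addrACA.
        by rewrite -[p (val y).1 - p g]opprB subrr addr0.
      by apply: (submodB sK) => //; apply: (submodB sK).
    have v0 : (val y).1 = 0 by rewrite y0.
    by move: Kgy; rewrite v0 linear0 !addr0; exact: tT.2.
  - split; first exact: SjD.
    move=> x y [Sy|->] xy; left; last exact/ltj.
    exact: cS Sy xy.
  - apply/seteqP; split=> w.
      move=> [_ [g [y [Tg T1y ->]]]]; rewrite linearD => Kw.
      have [Sy Ky] := SSP y.
      have [a Sa Ka] : phi S (p g) by rewrite -eT; exists g => //; rewrite subrr; exact: sK.1.
      exists (a + e * (val y).2).
        apply: (submodD (fspan_submod _)).
          by apply: fspan_sub Sa => V; apply: galg_sub => i Si; left.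
        apply: fspan_mul; first by apply: galg_gen; right.
        by apply: fspan_sub Sy => V; apply: galg_sub => i Si; left.
      have -> : w - (a + e * (val y).2) = (w - (p g + p (val y).1)) + (p g - a) + (p (val y).1 - e * (val y).2).
        by rewrite -[RHS]addrA [p g - a + _]addrACA -opprD addrA subrK.
      by apply: (submodD sK) => //; apply: (submodD sK).
    (* Modulo K, [w] is a + e * b. [T1] accounts for b up to the colon ideal, which leaves an error
       c in the span of [galg S]; then a + c is absorbed by T. *)
    move=> [_ /fspan_adjoin[a [b [Sa Sb ->]]] Kw].
    have [y T1y /KS[c Sc Kc]] := T1s b Sb.
    have [Sy Ky] := SSP y.
    have [g Tg Kg] : img p K T (a + c).
      rewrite eT; exists (a + c); last by rewrite subrr; exact: sK.1.
      exact: (submodD eS).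
    exists (g + (val y).1); first by exists g, y.
    rewrite linearD.
    have -> : w - (p g + p (val y).1) = (w - (a + e * b)) + (a + c - p g) +
        (e * (b - p' y) - c) - (p (val y).1 - e * (val y).2).
      rewrite mulrBr -[p' y]/((val y).2); move: (e * (val y).2) => ew.
      rewrite !opprD !opprK !addrA.
      by rewrite [RHS](ACl (1*6*10*(4*2)*(7*3)*(5*9)*(11*8)))/= !subrr !addr0.
    apply: (submodB sK) => //; apply: (submodD sK) => //; exact: (submodD sK).
exists T; split=> // a Da.
rewrite eT; exists a; last by rewrite subrr; exact: sK.1.
by apply: fspan_sub Da => V; exact: galg_sub.
Qed.
Lemma splits_setT : splits setT.
Proof.
apply: splits_step => // j _; move: j; apply: (wo_induction woR) => j IH.
by apply: splits_step => // i l lj il; exact: (wlt_trans woR il lj).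
Qed.

End NoebelingTheorem.

(** With all subsets as generators, the span of [galg setT] consists of the finitely valued
    functions, and the ideal {set0} spans 0. So [splits_setT] provides a section of the pullback E
    of [p0] along [f], whose first component is the lift. *)
Theorem fvfun_projective (k : comPzRingType) (G : groupType) :
  projective (fvfun k G : lmodType k).
Proof.
move=> M N p0 f sp0.
pose d := (p0 \o fst) \- (f \o snd) : {linear (M * fvfun k G)%type -> N}.
pose E : lmodType k := kermod d.
pose q : {linear E -> fvfun k G} := snd \o (val : {linear E -> _}).
have lv : linear (fun b : fvfun k G => val b : G -> k^o) by move=> c x y.
pose p : {linear E -> (G -> k^o)} := lin_of lv \o q.
have sq : surj q.
  move=> b; have [m mE] := sp0 (f b).
  have kx : ker_pred d (m, b) by apply/eqP; rewrite /d /= mE subrr.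
  by exists (exist _ (m, b) kx).
have idJ : ideal setT [set (set0 : set G)].
  split=> // [U ->|U V ->|U V -> ->]; rewrite ?setU0 //; first exact: galg0.
  by rewrite subset0.
have J0 (g : G -> k^o) : fspan [set (set0 : set G)] g <-> g = 0.
  split=> [|->]; last exact: fspan0.
  move=> Jg; have [||U -> g0] := fspan_support _ _ Jg => //; first by move=> U V -> ->; rewrite setU0.
  by apply/funext => x; exact: g0.
have [R woR] := well_ordering_principle (set G).
have [|T [tT Ts]] := splits_setT woR idJ (p := p).
  move=> a /fspan_range fa; have fva : finite_valued a by apply/asboolP.
  have [x xE] := sq (exist _ a fva); exists x; apply/J0.
  by rewrite -[p x]/(val (q x)) xE subrr.
have [||s sP] := @transversal_section k E _ q T tT.1.
- by move=> x Tx qx; apply: tT.2 => //; apply/J0; rewrite -[p x]/(val (q x)) qx.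
- move=> b; have /asboolP fb := valP b.
  have [|x Tx /J0 e] := Ts (val b).
    by apply: fspan_of_levels => // v _; exact: galg_gen.
  exists x => //; apply: val_inj; apply/esym/eqP; rewrite -subr_eq0; apply/eqP.
  exact: e.
exists (fst \o (val \o s)) => b /=.
have := ker_val (s b); rewrite /d /= => /eqP; rewrite subr_eq0 => /eqP ->.
by congr (f _); have [] := sP b.
Qed.

Lemma projective_resk_repmod (k : comPzRingType) (G : groupType) (V : lmodType k)
  (r : grep G V) : projective V -> projective (resk (repmod r)).
Proof.
move=> projV M N p f sp.
have lf : linear (f : V -> N) by move=> c x y; rewrite -linearP (repmod_scale r).
have [h hE] := projV M N p (lin_of lf) sp.
have lh : linear (h : resk (repmod r) -> M).
  by move=> c x y; rewrite (repmod_scale r) linearP.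
by exists (lin_of lh).
Qed.

(** * The module of all functions from G to N *)

Section Coinduced.
Variables (k : comPzRingType) (G : groupType).
Local Notation kG := (grpring k G).
Local Notation B := (Bmod k G).

Lemma Bmod_projective : projective (resk B).
Proof. exact/projective_resk_repmod/fvfun_projective. Qed.

Variable N : lmodType kG.

Definition coind_act (g : G) (f : G -> resk N) : G -> resk N :=
  fun x => res_act g (f (g^-1 * x)%g).

Fact coind_act_linear g : linear (coind_act g).
Proof. by move=> c u v; apply/funext => x; rewrite /coind_act res_act_linear. Qed.
Fact coind_act1 f : coind_act 1%g f = f.
Proof. by apply/funext => x; rewrite /coind_act res_act1 invg1 mul1g. Qed.
Fact coind_actM g h f : coind_act (g * h)%g f = coind_act g (coind_act h f).
Proof. by apply/funext => x; rewrite /coind_act res_actM invgM mulgA. Qed.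

Definition coind : lmodType kG := repmod (Grep coind_act_linear coind_act1 coind_actM).

Lemma coind_embedding : exists j : {linear N -> coind}, injective j.
Proof.
have lj : linear ((fun n _ => n) : N -> coind).
  by apply: linear_to_rep => [c n m|g n]; apply/funext.
by exists (lin_of lj) => n m /(congr1 (fun f : G -> N => f 1%g)).
Qed.

Definition bval (b : B) : G -> k := val (b : fvfun k G).

Lemma bvalP c (b b' : resk B) x : bval (c *: b + b') x = c * bval b x + bval b' x.
Proof.
exact: (congr1 (fun u : fvfun k G => val (u + (b' : fvfun k G)) x)
  (repmod_scale (Grep (@fv_act_linear k G) (@fv_act1 k G) (@fv_actM k G)) c b)).
Qed.

Lemma bval_gdelta g b x : bval (gdelta k g *: b) x = bval b (g^-1 * x)%g.
Proof. by rewrite /bval repmod_gdelta. Qed.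

Definition cval (f : coind) : G -> resk N := f.

Lemma cvalP c (f f' : resk coind) x : cval (c *: f + f') x = c *: cval f x + cval f' x.
Proof.
exact: (congr1 (fun u : G -> resk N => (u + (f' : G -> resk N)) x)
  (repmod_scale (Grep coind_act_linear coind_act1 coind_actM) c f)).
Qed.

Lemma cval_gdelta g f x : cval (gdelta k g *: f) x = gdelta k g *: (cval f (g^-1 * x)%g : N).
Proof. by rewrite /cval repmod_gdelta. Qed.

Lemma cval_inj f f' : (forall x, cval f x = cval f' x) -> f = f'.
Proof. by move=> ff'; apply/funext. Qed.

(* Pointwise multiplication makes coind a module over the ring B, hence a retract of
   Hom_k(B, coind). *)
Lemma extends_coind (M : lmodType kG) : extends M (homM B coind) -> extends M coind.
Proof.
pose m (f : coind) : resk B -> resk coind :=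
  fun b => (fun x => bval b x *: cval f x) : G -> resk N.
have mE f b x : cval (m f b) x = bval b x *: cval f x by [].
have lm f : linear (m f).
  by move=> c b b'; apply: cval_inj => x; rewrite cvalP !mE bvalP scalerDl scalerA.
have /choice[mu muE] f := hom_of (lm f).
have lmu : linear mu.
  apply: linear_to_hom => [b c f f'|g f b]; apply: cval_inj => x; rewrite !muE.
    by rewrite cvalP !mE cvalP scalerDr !scalerA mulrC.
  rewrite cval_gdelta !mE !cval_gdelta bval_gdelta invgK mulVKg.
  by have := @res_act_linear k G N g (bval b x) (cval f (g^-1 * x)%g) 0;
    rewrite /res_act !addr0 scaler0 addr0.
(* The constant function 1 is fixed by G, so evaluation at it is kG-linear, and it undoes
   multiplication. *)
have one_fv : finite_valued ((fun=> 1) : G -> k^o).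
  apply/asboolP; apply: (sub_finite_set (B := [set 1])) => //.
  by move=> _ [x _ <-].
pose one : B := exist (fun h => finite_valued h) _ one_fv.
have gone g : gdelta k g *: one = one by apply/val_inj/funext => x; exact: bval_gdelta.
pose ev (h : homM B coind) : coind := hfun h one.
have lev : linear ev.
  apply: grp_linear => [c h h'|g h].
    exact: (@hom_linear k G B coind _ (idfun : {linear homM B coind -> _}) one c h h').
  rewrite /ev; have /= -> := @hom_equivariant k G B coind _ (idfun : {linear homM B coind -> _}) g h one.
  by rewrite gone.
apply: (@extends_retract _ _ _ _ (lin_of lmu) (lin_of lev)) => f /=.
by rewrite /ev muE; apply: cval_inj => x; rewrite mE /bval /= scale1r.
Qed.

End Coinduced.

(** * Deconstruction of cofibrant modules *)

Lemma grp_submod (k : comPzRingType) (G : groupType) (M : lmodType (grpring k G)) (S : set M) :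
  S 0 -> (forall x y, S x -> S y -> S (x + y)) ->
  (forall c x, S x -> S ((c *: (1 : grpring k G)) *: x)) ->
  (forall g x, S x -> S (gdelta k g *: x)) -> submod S.
Proof.
move=> S0 SD Sc Sg; split=> // a x y Sx Sy; apply: (SD) => //.
pose ax := free_ext (fun g => (gdelta k g *: x : resk M)) a.
have -> : a *: x = ax.
  by rewrite -[in LHS](free_ext_id a) [LHS](linear_sum (lin_of (scale_grpring_linear x)))
    /ax /free_ext; apply: eq_bigr => g _; rewrite linearZ.
apply: (big_ind S) => [//||g _]; first exact: SD.
by apply: Sc; apply: Sg.
Qed.

Section Deconstruction.
Variables (k : comPzRingType) (G : groupType).
Local Notation kG := (grpring k G).
Variable X : lmodType kG.
Hypothesis projX : projective (resk X).

(** A word is an address, read from the right: a letter (x, n) moves from m to the n-th element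
    occurring in the decomposition of s (tens m x). Words mention X but not M, so the same [wfree]
    serves every M. *)
Definition words : choiceType := seq (X * nat).
Definition wfree : lmodType kG := freemod kG words.

Definition small_kernels : set (set wfree) := fun K =>
  submod K /\ projective (diag_tensor (quotmod K) X).

Section Good.
Variable M : lmodType kG.
Local Notation P := (diag_tensor M X).
Variables (s : {linear P -> freemod kG P}) (rep : P -> seq (M * X)).
Hypotheses (sK : cancel s (free_cover P))
  (repE : forall t, t = \sum_(z <- rep t) tens (z.1 : resk M) (z.2 : resk X)).

(* [s] maps the image of [S (x) X] into the free module on that image; phrased with the
   fixed decompositions [rep] in order to be stable under unions. *)
Definition good (S : set M) := submod S /\
  forall m x t z, S m -> t \in finsupp (s (tens (m : resk M) (x : resk X))) ->
    z \in rep t -> S z.1.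

(* The section [s] maps [range j (x) X] into the free module on itself, and likewise for
   [j (ker q)]; so it induces a section for the subquotient [L (x) X]. *)
Lemma good_subquotient (L' L : lmodType kG) (j : {linear L' -> M}) (q : {linear L' -> L}) :
  injective j -> surj q -> good (range j) -> good (j @` lker q) ->
  projective (diag_tensor L X).
Proof.
move=> ij sq [_ gj] [_ gk] Y Z p f sp.
have [J [JE Jinj]] := tens_map X j; have {}Jinj : injective J by exact: Jinj.
have [Q [QE _]] := tens_map X q.
(* If t decomposes inside j (ker q), its preimage under J dies under Q; so the two demands made on
   [psi] below are compatible. *)
pose small (t : P) := forall z, z \in rep t -> (j @` lker q) z.1.
have smallP t t' : small t -> J t' = t -> Q t' = 0.
  move=> small_t Jt'.
  have /choice[y yE] (z : M * X) : exists y, z \in rep t -> q y = 0 /\ j y = z.1.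
    case: (boolP (z \in rep t)) => [/small_t[y qy jy]|]; last by exists 0.
    by exists y.
  have -> : t' = \sum_(z <- rep t) (tens (y z : resk L') (z.2 : resk X) : diag_tensor L' X).
    apply: Jinj; rewrite Jt' {1}[t]repE linear_sum /= big_seq [RHS]big_seq.
    by apply: eq_bigr => z /yE[_ jy]; rewrite JE jy.
  rewrite linear_sum big_seq big1 // => z /yE[qy _]; rewrite QE qy.
  by rewrite -[X in tens X _](scale0r (0 : resk L)) tensZl scale0r.
(* [psi] lifts f (Q t') at each basis element t = J t' and is 0 at the small ones. Hence
   [free_ext psi \o s] lifts f after Q on the image of J and vanishes on the part coming from ker q,
   so it descends to L tensor X. *)
have /choice[psi psiP] (t : P) : exists y,
    (forall t', J t' = t -> p y = f (Q t')) /\ (small t -> y = 0).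
  case: (pselect (small t)) => [st|nst].
    by exists 0; split=> // t' /(smallP _ _ st) ->; rewrite !linear0.
  case: (pselect (exists t', J t' = t)) => [[t' Jt']|nt]; last first.
    by exists 0; split=> // t' Jt'; case: nt; exists t'.
  have [y yE] := sp (f (Q t')); exists y; split=> // t'' Jt''.
  by rewrite yE; congr (f (Q _)); apply: Jinj; rewrite Jt''.
pose h0 := free_ext psi \o s.
have pf t' : p (h0 (J t')) = f (Q t').
  apply: (diag_linear_eq (f := p \o (h0 \o J)) (f' := f \o Q)) t' => m x /=.
  rewrite JE; set t := tens (j m : resk M) _.
  have /choice[r rE] u : exists v, u \in finsupp (s t) -> J v = u.
    case: (boolP (u \in finsupp (s t))) => [us|]; last by exists 0.
    have /choice[y yE] (z : M * X) : exists y, z \in rep u -> j y = z.1.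
      case: (boolP (z \in rep u)) => [zu|]; last by exists 0.
      by have [y _ jy] := gj _ _ _ _ (ex_intro2 _ _ m I erefl) us zu; exists y.
    exists (\sum_(z <- rep u) (tens (y z : resk L') (z.2 : resk X) : diag_tensor L' X)) => _.
    rewrite [RHS]repE linear_sum big_seq [RHS]big_seq.
    by apply: eq_bigr => z /yE jy; rewrite JE jy.
  rewrite /free_ext !linear_sum.
  transitivity (f (Q (\sum_(u <- finsupp (s t)) s t u *: r u))).
    rewrite !linear_sum big_seq [RHS]big_seq; apply: eq_bigr => u us.
    by rewrite !linearZ /=; congr (_ *: _); apply: (psiP u).1; exact: rE.
  congr (f (Q _)); apply: Jinj; rewrite JE -/t.
  have e : t = \sum_(u <- finsupp (s t)) s t u *: u by rewrite -{1}[t]sK.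
  rewrite [RHS]e linear_sum big_seq [RHS]big_seq; apply: eq_bigr => u us.
  by rewrite linearZ /= rE.
have [h hE] := curry (h0 \o J).
have [|g gE] := surj_factor sq (linearP h).
  move=> m qm; apply: hfun_inj => x; rewrite hE /= JE hfun0 /free_ext big_seq big1 // => t ts.
  rewrite (psiP t).2 ?scaler0 // => z zt.
  by apply: gk zt; [|exact: ts]; exists m.
have [l lE] := uncurry g; exists l.
apply: (diag_linear_eq (f := p \o l)) => m x /=.
by have [y <-] := sq m; rewrite lE gE hE -QE; exact: pf.
Qed.

Definition successors (m : M) (x : X) : seq M :=
  flatten [seq [seq z.1 | z <- rep t] | t <- finsupp (s (tens (m : resk M) (x : resk X)))].

(** An index out of range gives 0, which lies in every submodule. *)
Fixpoint word_gen (c : M) (w : seq (X * nat)) : M :=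
  if w is (x, n) :: w' then nth 0 (successors (word_gen c w') x) n else c.

Definition word_map (c : M) : {linear wfree -> M} := free_ext (word_gen c : words -> M).

Definition adjoin (S : set M) (c : M) : set M := fun m => exists v, S (m - word_map c v).

(** The elements m for which all s (tens m x) decompose inside S' form a submodule [AA]. It contains
    S, and also each [word_gen c w], whose successors are addressed by words one letter longer;
    hence it contains S'. *)
Lemma good_adjoin S c : good S -> good (adjoin S c).
Proof.
move=> [sS gS]; pose S' := adjoin S c.
have sS' : submod S'.
  split; first by exists 0; rewrite linear0 subr0; exact: sS.1.
  move=> a m m' [v Sv] [v' Sv']; exists (a *: v + v').
  by rewrite linearP opprD addrACA -scalerBr; apply: sS.2.
split=> //.
have gen_S' w : S' (word_gen c w).
  by exists (basis kG (w : words)); rewrite /= free_ext_basis subrr; exact: sS.1.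
pose TT : set P := fun y => forall t z, t \in finsupp (s y) -> z \in rep t -> S' z.1.
have sTT : submod TT.
  split=> [t z|a y y' Ty Ty' t z]; first by rewrite linear0 mem_finsupp fm0 eqxx.
  rewrite linearP mem_finsupp fmD fmZ.
  have [t1|t1] := boolP (t \in finsupp (s y)); first by move=> _; exact: Ty.
  have [t2|t2] := boolP (t \in finsupp (s y')); first by move=> _; exact: Ty'.
  by rewrite (fsfun_dflt t1) (fsfun_dflt t2) mulr0 addr0 eqxx.
(* Quantifying over all x gives stability under G, as tens (g m) x = g (tens m (g^-1 x)). *)
pose AA : set M := fun m => forall x : X, TT (tens (m : resk M) (x : resk X)).
have sAA : submod AA.
  apply: grp_submod.
  - move=> x; rewrite -[X in tens X _](scale0r (0 : resk M)) tensZl scale0r; exact: sTT.1.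
  - by move=> m m' Am Am' x; rewrite (@tensDl k (resk M)); apply: (submodD sTT).
  - move=> a m Am x; rewrite (_ : tens _ _ = (a *: (1 : kG)) *: (tens (m : resk M) (x : resk X) : P)).
      exact: (submodZ sTT).
    by rewrite -[LHS]/(tens (a *: (m : resk M)) (x : resk X)) tensZl; apply/esym/repmod_scale.
  - move=> g m Am x.
    rewrite (_ : tens _ _ = gdelta k g *: (tens (m : resk M) (gdelta k g^-1%g *: x : resk X) : P)).
      exact: (submodZ sTT).
    by rewrite diag_tensor_gdelta scalerA gdeltaM mulgV gdelta1 scale1r.
have SAA m : S m -> AA m.
  move=> Sm x t z ts zt; exists 0; rewrite linear0 subr0.
  exact: gS Sm ts zt.
have genAA w : AA (word_gen c w).
  move=> x t z ts zt.
  have zs : z.1 \in successors (word_gen c w) x.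
    by apply/flattenP; exists [seq z.1 | z <- rep t]; apply: map_f.
  suff <- : word_gen c ((x, index z.1 (successors (word_gen c w) x)) :: w) = z.1 by [].
  by rewrite /= nth_index.
suff AAS m : S' m -> AA m by move=> m x t z /AAS; exact.
move=> [v Sv]; rewrite -[m](subrK (word_map c v)); apply: (submodD sAA); first exact: SAA.
by apply: (submod_sum sAA) => w _; apply: (submodZ sAA).
Qed.

(** The quotient of [wfree] by this kernel is isomorphic to [adjoin S c] modulo S. Both submodules
    are good, so [good_subquotient] applies. *)
Lemma adjoin_small S c : good S -> small_kernels (fun v => S (word_map c v)).
Proof.
move=> gS; have sS := gS.1; have [sS' _] := good_adjoin c gS.
pose K : set wfree := fun v => S (word_map c v).
have sK' : submod K := preim_submod (word_map c) sS.
split=> //; pose L' : lmodType kG := kermod (qpi (adjoin S c)).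
pose j : {linear L' -> M} := val.
have L'P (y : L') : adjoin S c (j y) by apply/(qpi_eq0 _ sS')/ker_val.
have L'ex m : adjoin S c m -> exists y : L', j y = m.
  move=> /(qpi_eq0 _ sS')/eqP km.
  by exists (exist (fun y => ker_pred (qpi (adjoin S c)) y) m km).
have /choice[v vE] (y : L') : exists v, S (j y - word_map c v) by exact: L'P.
have lq : linear (fun y : L' => qpi K (v y)).
  move=> a y y'; rewrite -linearP; apply/eqP; rewrite -subr_eq0 -linearB; apply/eqP.
  apply/(qpi_eq0 _ sK'); rewrite /K linearB linearP.
  have -> : word_map c (v (a *: y + y')) - (a *: word_map c (v y) + word_map c (v y')) =
     (a *: (j y - word_map c (v y)) + (j y' - word_map c (v y'))) -
     (j (a *: y + y') - word_map c (v (a *: y + y'))).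
    by rewrite (linearP j) scalerBr addrACA -opprD opprB [RHS]addrC addrA subrK.
  by apply: (submodB sS); [apply: sS.2|]; exact: vE.
apply: (@good_subquotient L' _ j (lin_of lq)).
- exact: val_inj.
- move=> y; have [u <-] := qpi_surj y.
  have [|z zE] := L'ex (word_map c u); first by exists u; rewrite subrr; exact: sS.1.
  exists z => /=; apply/eqP; rewrite -subr_eq0 -linearB; apply/eqP.
  apply/(qpi_eq0 _ sK'); rewrite /K linearB -zE -opprB; apply: (submodN sS).
  exact: vE.
- rewrite (_ : range _ = adjoin S c); first exact: good_adjoin.
  by apply/seteqP; split=> [_ [y _ <-]//|m /L'ex[y <-]]; exists y.
- rewrite (_ : _ @` _ = S) //; apply/seteqP; split=> m.
    move=> [y /(qpi_eq0 _ sK') Ky <-]; rewrite -(subrK (word_map c (v y)) (j y)).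
    exact: (submodD sS).
  move=> Sm; have [|y yE] := L'ex m; first by exists 0; rewrite linear0 subr0.
  exists y => //; apply/(qpi_eq0 _ sK'); rewrite /K -[word_map _ _](subKr (j y)).
  by apply: (submodB sS) => //; rewrite yE.
Qed.

End Good.
(** In an extension E of M by Z, sections over good submodules S are grown until S is M. A partial
    section is recorded by its image [T], on which [p] is injective; this is why [D] is zero. *)
Theorem deconstruction (M Z : lmodType kG) :
  projective (diag_tensor M X) -> extends_kernels small_kernels Z -> extends M Z.
Proof.
move=> projM extZ; apply: extends_of_split => E p i sp ij ker_p.
pose P := diag_tensor M X.
have [s sK] := projM _ _ (free_cover P) idfun (@free_cover_surj _ P).
have /choice[rep repE] (t : P) : exists r : seq (M * X),
    t = \sum_(z <- r) tens (z.1 : resk M) (z.2 : resk X) by have [r rE] := tensor_seq t; exists r; exact: rE.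
pose D : set M := [set 0].
have imgE (T : set E) m : img p D T m <-> exists2 x, T x & p x = m.
  split=> -[x Tx]; first by move=> /eqP; rewrite subr_eq0 => /eqP->; exists x.
  by move=> <-; exists x => //; rewrite /D /= subrr.
have [||||||T [S [tT _ eT fS]]] := @transversal_chain kG E M p D M
    (good s rep) id setT [set 0] [set 0].
- by split=> [|x ->//]; split=> // c x y -> ->; rewrite scaler0 addr0.
- split; first by split=> // c x y -> ->; rewrite scaler0 addr0.
  move=> m x t z -> ; rewrite (_ : tens _ _ = 0); last first.
    by rewrite -[X in tens X _](scale0r (0 : resk M)) tensZl scale0r.
  by rewrite linear0 mem_finsupp fm0 eqxx.
- apply/seteqP; split=> m; first by move=> /imgE[x -> <-]; rewrite linear0.
  by move=> ->; apply/imgE; exists 0; rewrite ?linear0.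
- move=> F F0 Ft FP; split=> //; split.
    by apply: bigcup_submod => // S /FP[].
  by move=> m x t z [S FS Sm] ts zt; exists S => //; have [_ gS] := FP _ FS; exact: gS Sm ts zt.
- by [].
- move=> T S tT gS; rewrite [id S]/= => eT [c _ nSc]; pose u := word_map s rep c.
  have gS' := good_adjoin c gS.
  pose K : set wfree := fun v => S (u v).
  have KK : small_kernels K by exact: (@adjoin_small M s rep sK repE S c gS).
  have [l lE] : exists l : {linear wfree -> E}, forall v, p (l v) = u v.
    by apply: (free_projective (p := p)).
  have /choice[ga gaE] v : exists x, K v -> T x /\ p x = u v.
    case: (pselect (K v)) => [Kv|]; last by exists 0.
    have : img p D T (u v) by rewrite eT.
    by move=> /imgE[x Tx xE]; exists x.
  have uniq x y : T x -> T y -> p x = p y -> x = y.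
    move=> Tx Ty pxy; apply/eqP; rewrite -subr_eq0; apply/eqP/tT.2.
      exact: (submodB tT.1).
    by rewrite /D /= linearB pxy subrr.
  have sK' : submod K := KK.1.
  have [||||g gE] := extends_kernels_ker _ extZ ij ker_p (K := K) (h := fun v => l v - ga v).
  (* On K the lift [l] of [u] and the section given by [T] differ by a map into the copy of Z, which
     extends to [g] on [wfree]. Then l - g still lifts [u] and sends K into [T], so it glues with
     [T]. *)
  + by move=> K' [].
  + exact: KK.
  + move=> a v w Kv Kw; rewrite linearP scalerBr addrACA -opprD; congr (_ - _).
    have [Tv pv] := gaE v Kv; have [Tw pw] := gaE w Kw.
    have [Tvw pvw] := gaE _ (sK'.2 a v w Kv Kw).
    apply: uniq => //; first exact: tT.1.2.
    by rewrite pvw !linearP pv pw.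
  + by move=> v Kv; rewrite linearB lE (gaE v Kv).2 subrr.
  pose l' v := l v - g v.
  have ll' : linear l'.
    by move=> a v w; rewrite /l' (linearP l) (linearP g) scalerBr opprD addrACA.
  have l'0 : l' 0 = 0 := linear0 (lin_of ll').
  have l'P v : p (l' v) = u v by rewrite linearB lE (gE v).1 subr0.
  have l'K v : K v -> T (l' v) by move=> Kv; rewrite /l' (gE v).2 // subKr; exact: (gaE v Kv).1.
  pose T' : set E := fun x => exists t v, T t /\ x = t + l' v.
  exists T', (adjoin s rep S c); split; split=> //.
  + split.
      split; first by exists 0, 0; rewrite l'0 addr0; split=> //; exact: tT.1.1.
      move=> a _ _ [t [v [Tt ->]]] [t' [v' [Tt' ->]]]; exists (a *: t + t'), (a *: v + v').
      split; first exact: tT.1.2.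
      by rewrite ll' scalerDr addrACA.
    move=> x [t [v [Tt ->]]]; rewrite /D /= linearD l'P => e.
    have Kv : K v.
      have Spt : S (p t) by rewrite -eT; apply/imgE; exists t.
      rewrite /K (_ : u v = - p t); first exact: (submodN gS.1).
      by apply/eqP; rewrite -addr_eq0 addrC e.
    by apply: tT.2; [apply: (submodD tT.1) => //; exact: l'K|rewrite /D /= linearD l'P].
  + apply/seteqP; split=> m.
      move=> /imgE[_ [t [v [Tt ->]]] <-]; exists v; rewrite linearD l'P addrK -eT.
      by apply/imgE; exists t.
    move=> [v Sv]; have /imgE[t Tt tE] : img p D T (m - u v) by rewrite eT.
    by apply/imgE; exists (t + l' v); [exists t, v|rewrite linearD l'P tE subrK].
  + by move=> x Tx; exists x, 0; rewrite l'0 addr0.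
  + by move=> m Sm; exists 0; rewrite linear0 subr0.
  + exists c => //; exists (basis kG ([::] : words)).
    by rewrite /= free_ext_basis subrr; exact: gS.1.1.
have [||s' s'P] := transversal_section (p := p) tT.1.
- exact: tT.2.
- move=> y; have /imgE[x Tx xy] : img p D T y by rewrite eT; exact: fS.
  by exists x.
- by exists s' => y; have [] := s'P y.
Qed.

End Deconstruction.

(** * The cotorsion pair *)

(** The map is extended in two stages, from ker r to ker (e r) and from there to P: ker (e r) is a
    cover of A with kernel ker r, and P is a cover of C. *)
Lemma extends_extension (R : pzRingType) (A E C Z : lmodType R)
    (a : {linear A -> E}) (e : {linear E -> C}) :
  short_exact a e -> extends A Z -> extends C Z -> extends E Z.
Proof.
move=> [ia se ex] extA extC P r sr h lh.
pose d : {linear P -> C} := e \o r; pose P1 : lmodType R := kermod d.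
have /choice[t tE] (y : P1) : exists x, a x = r (val y) by apply/ex/(ker_val y).
have lt : linear t.
  by move=> c y y'; apply: ia; rewrite linearP !tE [val _]linearP linearP.
have [||g1 g1E] := extA P1 (lin_of lt) _ (h \o val).
- move=> x; have [y yE] := sr (a x).
  have ky : ker_pred d y by apply/eqP; rewrite /d /= yE; apply/ex; exists x.
  by exists (exist (fun y => ker_pred d y) y ky); apply: ia; rewrite /= tE.
- have tr (y : P1) : t y = 0 -> r (val y) = 0 by move=> ty; rewrite -tE ty linear0.
  by move=> c y y' ty ty'; rewrite /= -lh //; exact: tr.
have /choice[mk mkE] y : exists z : P1, d y = 0 -> val z = y.
  case: (pselect (d y = 0)) => [/eqP ky|]; last by exists 0.
  by exists (exist (fun y => ker_pred d y) y ky).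
have [||g gE] := extC P d _ (g1 \o mk).
- by move=> y; have [x <-] := se y; have [z <-] := sr x; exists z.
- move=> c y y' dy dy'; rewrite /= -linearP; congr (g1 _); apply: val_inj.
  have dyy := (lker_submod d).2 c y y' dy dy'.
  by rewrite [RHS]linearP /= (mkE _ dyy) (mkE _ dy) (mkE _ dy').
exists g => y ry; have dy : d y = 0 by rewrite /d /= ry linear0.
by rewrite gE //= g1E /= ?mkE //; apply: ia; rewrite linear0 tE mkE.
Qed.

Section Cofibrant.
Variables (k : comPzRingType) (G : groupType).
Local Notation kG := (grpring k G).
Local Notation B := (Bmod k G).
Local Notation Cof := (@cofibrant k G).
Local Notation small := (@small_kernels k G B).

Let projB : projective (resk B) := @Bmod_projective k G.

Lemma rperp_cofibrantP (Z : lmodType kG) : rperp Cof Z <-> extends_kernels small Z.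
Proof.
split=> [perpZ K h [sK projK] lh|extZ M cofM]; last exact/Ext1P/(deconstruction projB).
have [|g gE] := (Ext1P _ _).1 (perpZ _ projK) _ (qpi K) (@qpi_surj _ _ K) h.
  by move=> c x y /(qpi_eq0 _ sK) Kx /(qpi_eq0 _ sK) Ky; exact: lh.
by exists g => x Kx; apply: gE; apply/(qpi_eq0 _ sK).
Qed.

Lemma rperp_hom (Z : lmodType kG) : rperp Cof (homM B Z).
Proof. by move=> M cofM; apply/Ext1P/(extends_hom projB). Qed.

Lemma rperp_coind (N : lmodType kG) : rperp Cof (coind N).
Proof. by move=> M cofM; apply/Ext1P/extends_coind/Ext1P/rperp_hom. Qed.

Lemma cofibrantP (M : lmodType kG) : Cof M <-> lperp (rperp Cof) M.
Proof.
split=> [cofM Z|H]; first exact.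
by apply: (diag_projective_of_extends projB) => Z; apply/Ext1P/H/rperp_hom.
Qed.

Lemma cofibrant_syzygy (M : lmodType kG) n : Cof M -> Cof (syzygy M n).
Proof.
move=> cofM; elim: n => [//|n IH].
by apply: diag_projective_ker => //; [exact: free_cover_surj|exact: free_projective].
Qed.

Lemma cofibrant_coresolution (M : lmodType kG) :
  exists (V U : lmodType kG) (i : {linear M -> V}) (p : {linear V -> U}),
    [/\ Cof U, rperp Cof V & short_exact i p].
Proof.
have [j ij] := coind_embedding M.
have sub K : small K -> submod K by case.
have ext_coind : extends_kernels small (coind M) by apply/rperp_cofibrantP/rperp_coind.
have [V [U [i [p [ex extV extU]]]]] :=
  small_object (@free_projective kG _) sub ij ext_coind.
exists V, U, i, p; split=> //; last exact/rperp_cofibrantP.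
apply: (diag_projective_of_extends projB) => Z; apply: extU.
exact/rperp_cofibrantP/rperp_hom.
Qed.

(** Salce's trick: embed the kernel of a free cover F -> M into V with cofibrant cokernel U, and
    push F out along this embedding. The pushout E maps onto M with kernel V, and it is an extension
    of U by F, so it inherits the vanishing of Ext^1 into Hom_k(B, Z). *)
Lemma cofibrant_resolution (M : lmodType kG) :
  exists (V U : lmodType kG) (i : {linear V -> U}) (p : {linear U -> M}),
    [/\ Cof U, rperp Cof V & short_exact i p].
Proof.
pose F : lmodType kG := freemod kG M; pose q : {linear F -> M} := free_cover M.
have sq : surj q := @free_cover_surj _ M.
have [V [U [i [p [cofU perpV [ii sp ip]]]]]] := cofibrant_coresolution (kermod q).
(* [f] is [i] read as a function on F, to fit [linear_on]; elements outside the kernel may get the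
   value 0. *)
have /choice[f fE] (x : F) : exists v, forall y : kermod q, val y = x -> v = i y.
  case: (pselect (q x = 0)) => [/eqP kx|nx].
    by exists (i (exist (fun y => ker_pred q y) x kx)) => y yx; congr (i _); apply: val_inj.
  by exists 0 => y yx; case: nx; rewrite -yx ker_val.
have kerE (x : F) : q x = 0 -> exists2 y : kermod q, val y = x & f x = i y.
  move=> /eqP kx; exists (exist (fun y => ker_pred q y) x kx) => //.
  exact: fE.
have lf : linear_on (lker q) f.
  move=> c x y /kerE[x' <- ->] /kerE[y' <- ->].
  by rewrite -(linearP i) -(fE _ (c *: x' + y') erefl) linearP.
have [E [pi [r [spi pi0 rE]]]] := pushout sq lf.
have lj : linear (fun v : V => pi (0, v)).
  by move=> c x y; rewrite -linearP; congr (pi (_, _)); rewrite /= scaler0 addr0.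
have la : linear (fun x : F => pi (x, 0)).
  by move=> c x y; rewrite -linearP; congr (pi (_, _)); rewrite /= scaler0 addr0.
have f0 : f 0 = 0 := linear_on0 lf (linear0 q).
have pif x : q x = 0 -> pi (x, 0) = pi (0, f x).
  move=> qx; apply/eqP; rewrite -subr_eq0 -linearB; apply/eqP/pi0.
  by rewrite /= subr0 sub0r.
exists V, E, (lin_of lj), r; split=> //; last first.
  split.
  - move=> v w vw; apply/eqP; rewrite -subr_eq0; apply/eqP.
    have /pi0[_ ->] : pi (0, v - w) = 0; last by rewrite f0 oppr0.
    by rewrite -[pi _]/(lin_of lj (v - w)) linearB vw subrr.
  - by move=> m; have [x <-] := sq m; exists (pi (x, 0)); rewrite rE.
  - move=> y; split=> [|[v <-]]; last by rewrite /= rE linear0.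
    have [[x v] <-] := spi y; rewrite rE /= => qx; exists (f x + v).
    rewrite /= -[(0, _)]/((0, f x + v) : F * V) (_ : (0, f x + v) = (0, f x) + (0, v)).
      by rewrite linearD -pif // -linearD; congr (pi (_, _)); rewrite /= ?addr0 ?add0r.
    by congr (_, _); rewrite /= addr0.
have [|e eE] := surj_factor (f := p \o snd) spi (linearP _).
  move=> [x v] /pi0[/= qx ->]; have [y _ ->] := kerE x qx.
  by rewrite linearN; apply/eqP; rewrite oppr_eq0; apply/eqP/ip; exists y.
apply: (diag_projective_of_extends projB) => Z.
apply: (@extends_extension _ F E U _ (lin_of la) e).
- split.
  + move=> x y xy; apply/eqP; rewrite -subr_eq0; apply/eqP.
    have /pi0[qxy] : pi (x - y, 0) = 0.
      by rewrite -[pi _]/(lin_of la (x - y)) linearB xy subrr.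
    move=> /esym/eqP; rewrite oppr_eq0; have [z <- ->] := kerE _ qxy.
    rewrite -(linear0 i) => /eqP/ii ->; exact: linear0.
  + by move=> u; have [v <-] := sp u; exists (pi (0, v)); rewrite eE.
  + move=> y; split=> [|[x <-]]; last by rewrite /= eE /= linear0.
    have [[x v] <-] := spi y; rewrite eE /= => /ip[z zv].
    have qz : q (val z) = 0 := ker_val z.
    have fz : f (val z) = i z := fE _ _ erefl.
    exists (x + val z); transitivity (pi (x, 0) + pi (val z, 0)).
      by rewrite -linearD; congr (pi (_, _)); rewrite /= addr0.
    by rewrite (pif _ qz) fz zv -linearD; congr (pi (_, _)); rewrite /= ?addr0 ?add0r.
- exact/projective_extends/free_projective.
- exact/Ext1P/rperp_hom.
Qed.

End Cofibrant.

Theorem theoremB (k : comPzRingType) (G : groupType) :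
  [/\ cotorsion_pair (@cofibrant k G) (rperp (@cofibrant k G)),
      hereditary (@cofibrant k G) (rperp (@cofibrant k G))
    & complete (@cofibrant k G) (rperp (@cofibrant k G))].
Proof.
split.
- by split=> [M|N]; [exact: cofibrantP|].
(* Dimension shifting reduces Ext^(n+1) to Ext^1 of the n-th syzygy, which is again cofibrant. *)
- move=> [//|n] M N _ cofM perpN; apply: (Ext_syzygy M N n).2.
  exact/perpN/cofibrant_syzygy.
- by move=> M; split; [exact: cofibrant_resolution|exact: cofibrant_coresolution].
Qed.
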